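(* Let $\mathcal X$ be a complex Banach space, let $A,B,C\in B(\mathcal X)$, and let $M_C=\begin{pmatrix} A & C\\ 0 & B\end{pmatrix}$ and $M_0=A\oplus B$, acting on $\mathcal X\oplus\mathcal X$. Then $$\sigma_b(M_0)=\sigma_b(M_C)\cup\{\Xi(A^* )\cap\Xi(B)\}.$$
   Context: $B(\mathcal Y)$ is the algebra of bounded linear operators on a complex Banach space $\mathcal Y$; $T^*$ is the adjoint of $T$ acting on the dual space. For $T\in B(\mathcal Y)$: $\alpha(T)=\dim T^{-1}(0)$, $\beta(T)=\dim(\mathcal Y/T\mathcal Y)$; $T$ is Fredholm at $\lambda\in\mathbb C$ if $(T-\lambda)\mathcal Y$ is closed, $\alpha(T-\lambda)<\infty$ and $\beta(T-\lambda)<\infty$. The ascent $\mathrm{asc}(T-\lambda)$ is the least integer $n\ge 0$ with $\ker(T-\lambda)^n=\ker(T-\lambda)^{n+1}$, and the descent $\mathrm{dsc}(T-\lambda)$ is the least integer $n\ge 0$ with $(T-\lambda)^n\mathcal Y=(T-\lambda)^{n+1}\mathcal Y$ (each is $\infty$ if no such $n$ exists). $T$ is Browder at $\lambda$ if it is Fredholm at $\lambda$ and $\mathrm{asc}(T-\lambda)=\mathrm{dsc}(T-\lambda)<\infty$; the Browder spectrum is $\sigma_b(T)=\{\lambda\in\mathbb C: T \text{ is not Browder at }\lambda\}$. $T$ has SVEP (the single-valued extension property) at $\lambda_0\in\mathbb C$ if for every open disc $\mathcal D$ centered at $\lambda_0$ the only analytic function $f:\mathcal D\to\mathcal Y$ with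 $(T-\lambda)f(\lambda)=0$ for all $\lambda\in\mathcal D$ is $f\equiv 0$. $\Xi(T)$ denotes the set of $\lambda\in\mathbb C$ at which $T$ does not have SVEP. *)

(* Defs.v *)
From HB Require Import structures.
From mathcomp Require Import all_boot all_order all_algebra.
From mathcomp Require Import complex.
From mathcomp Require Import boolp classical_sets functions reals topology.
From mathcomp Require Import tvs normedtype sequences.

Set Implicit Arguments.
Unset Strict Implicit.
Unset Printing Implicit Defensive.

Import Order.TTheory GRing.Theory Num.Theory.
Import numFieldNormedType.Exports.

Local Open Scope classical_set_scope.
Local Open Scope complex_scope.
Local Open Scope ring_scope.

Section BoundedOperators.
Variables (R : realType) (V W : normedModType R[i]).

Definition bounded_linear : {pred V -> W} := [pred f | `[<
  linear f /\ exists M : R[i], forall x, `|f x| <= M * `|x| >]].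

Lemma bounded_linearP (f : V -> W) :
  reflect (linear f /\ exists2 M : R, 0 <= M & forall x, `|f x| <= M%:C * `|x|)
          (f \in bounded_linear).
Proof.
apply: (iffP idP) => [|[lf [M _ fM]]]; last first.
  by rewrite inE; split => //; exists M%:C.
rewrite inE => -[lf [M fM]]; split=> //.
have [x0|x0] := pselect (exists x : V, x != 0); last first.
  exists 0 => // x; have -> : x = 0.
    by apply/eqP; apply: contra_notT x0 => xn0; exists x.
  have -> : f 0 = 0 by have := lf (-1) 0 0; rewrite scaler0 addr0 scaleN1r addNr.
  by rewrite !normr0 mulr0.
have [x xn0] := x0.
have M0 : 0 <= M.
  have : 0 <= M * `|x| by apply: le_trans (fM x).
  by rewrite pmulr_lge0 // normr_gt0.
have ME : M = (complex.Re M)%:C.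
  by move: M0; rewrite lecE => /andP[/eqP iM _]; case: (M) iM => a b /= ->.
exists (complex.Re M); first by move: M0; rewrite ME lecR.
by move=> y; rewrite -ME.
Qed.

Lemma bounded_linear_submod_closed : submod_closed bounded_linear.
Proof.
split.
  apply/bounded_linearP; split; last first.
    by exists 0 => // x; rewrite normr0 mul0r.
  by move=> a u v; rewrite [in RHS]/= scaler0 addr0.
move=> a f g /bounded_linearP[lf [M M0 fM]] /bounded_linearP[lg [N N0 gN]].
have fgE x : (a *: f + g) x = a *: f x + g x by [].
apply/bounded_linearP; split.
  move=> b u v; rewrite !fgE lf lg !scalerDr !scalerA (mulrC b a).
  by rewrite addrACA.
exists (complex.Re `|a| * M + N) => [|x].
  rewrite addr_ge0 // mulr_ge0 //.
  by have := normr_ge0 a; rewrite lecE => /andP[].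
have aE : (complex.Re `|a|)%:C = `|a| by rewrite normc_def.
rewrite fgE (le_trans (ler_normD _ _)) // rmorphD rmorphM /= aE mulrDl.
by rewrite lerD // normrZ -mulrA ler_wpM2l.
Qed.

HB.instance Definition _ :=
  GRing.isSubmodClosed.Build R[i] (V -> W) bounded_linear
    bounded_linear_submod_closed.

Record bop := Bop { bop_fun :> V -> W; _ : bop_fun \in bounded_linear }.

HB.instance Definition _ := [isSub for bop_fun].
HB.instance Definition _ := [Choice of bop by <:].
HB.instance Definition _ := [SubChoice_isSubLmodule of bop by <:].

Lemma bop_is_linear (f : bop) : linear f.
Proof. by have /bounded_linearP[] := valP f. Qed.

HB.instance Definition _ (f : bop) :=
  GRing.isLinear.Build _ _ _ _ f (bop_is_linear f).

Lemma bop_bound (f : bop) :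
  exists2 M : R, 0 <= M & forall x, `|f x| <= M%:C * `|x|.
Proof. by have /bounded_linearP[] := valP f. Qed.

Lemma bopP (f g : bop) : f =1 g -> f = g.
Proof. by move=> fg; apply/val_inj/funext. Qed.

(* Norms on modules over R[i] take values in R[i], where no supremum is
   available, so the supremum is taken of the real parts. *)
Definition opnorm (f : bop) : R :=
  sup [set complex.Re `|f x| | x in [set x : V | `|x| <= 1]].

Let normE (U : normedModType R[i]) (x : U) : `|x| = (complex.Re `|x|)%:C.
Proof.
have := normr_ge0 x; rewrite lecE => /andP[/eqP + _].
by case: `|x| => a b /= ->.
Qed.

Let unit_image_bounded (f : bop) (M : R) : 0 <= M ->
  (forall x, `|f x| <= M%:C * `|x|) ->
  ubound [set complex.Re `|f x| | x in [set x : V | `|x| <= 1]] M.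
Proof.
move=> M0 fM _ [x /= x1 <-]; rewrite -lecR -normE.
by rewrite (le_trans (fM x)) // ler_piMr // lecR.
Qed.

Lemma opnorm_ge0 (f : bop) : 0 <= opnorm f.
Proof.
have [M M0 fM] := bop_bound f.
apply: ub_le_sup; first by exists M; exact: unit_image_bounded.
by exists 0 => /=; rewrite ?linear0 ?normr0.
Qed.

Lemma opnorm_le (f : bop) (M : R) : 0 <= M ->
  (forall x, `|f x| <= M%:C * `|x|) -> opnorm f <= M.
Proof.
move=> M0 fM; apply: ge_sup; last exact: unit_image_bounded.
by exists 0; exists 0 => /=; rewrite ?linear0 ?normr0.
Qed.

Lemma ler_opnorm (f : bop) (x : V) : `|f x| <= (opnorm f)%:C * `|x|.
Proof.
have [->|xn0] := eqVneq x 0; first by rewrite linear0 !normr0 mulr0.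
have x0 : 0 < `|x| by rewrite normr_gt0.
have [M M0 fM] := bop_bound f.
rewrite -ler_pdivrMr //.
have -> : `|f x| / `|x| = `|f (`|x|^-1 *: x)|.
  by rewrite linearZ normrZ normfV normr_id mulrC.
rewrite normE lecR; apply: ub_le_sup.
  by exists M; exact: unit_image_bounded.
exists (`|x|^-1 *: x) => //=.
by rewrite normrZ normfV normr_id mulVf // gt_eqF.
Qed.

Lemma opnormD (f g : bop) :
  (opnorm (f + g))%:C <= (opnorm f)%:C + (opnorm g)%:C :> R[i].
Proof.
rewrite -rmorphD lecR; apply: opnorm_le => [|x].
  by rewrite addr_ge0 ?opnorm_ge0.
rewrite (le_trans (ler_normD _ _)) // rmorphD mulrDl.
by rewrite lerD ?ler_opnorm.
Qed.

Let opnormZ_le (a : R[i]) (f : bop) :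
  (opnorm (a *: f))%:C <= `|a| * (opnorm f)%:C :> R[i].
Proof.
have aE : (complex.Re `|a|)%:C = `|a| by rewrite normc_def.
rewrite -aE -rmorphM lecR; apply: opnorm_le => [|x].
  by apply: mulr_ge0; [rewrite -lecR aE; exact: normr_ge0|exact: opnorm_ge0].
by rewrite rmorphM /= aE normrZ -mulrA ler_wpM2l // ler_opnorm.
Qed.

Lemma opnormZ (a : R[i]) (f : bop) :
  (opnorm (a *: f))%:C = `|a| * (opnorm f)%:C :> R[i].
Proof.
apply/eqP; rewrite eq_le opnormZ_le /=.
have [->|an0] := eqVneq a 0; first by rewrite normr0 mul0r lecR opnorm_ge0.
have := opnormZ_le a^-1 (a *: f); rewrite scalerA mulVf // scale1r.
by rewrite normfV ler_pdivlMl // normr_gt0.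
Qed.

Lemma opnorm_eq0 (f : bop) : (opnorm f)%:C = 0 :> R[i] -> f = 0.
Proof.
move=> f0; apply: bopP => x; apply/eqP; rewrite -normr_le0.
by rewrite (le_trans (ler_opnorm f x)) // f0 mul0r.
Qed.

HB.instance Definition _ :=
  @Lmodule_isNormed.Build R[i] bop (fun f => (opnorm f)%:C)
    opnormD opnormZ opnorm_eq0.

Lemma bop_normE (f : bop) : `|f| = (opnorm f)%:C.
Proof. by []. Qed.

End BoundedOperators.
Arguments bounded_linear {R} V W.

Definition dual (R : realType) (V : normedModType R[i]) := bop V (R[i])^o.
HB.instance Definition _ (R : realType) (V : normedModType R[i]) :=
  NormedModule.on (dual V).

Section Operators.
Variable R : realType.

Implicit Types U V W : normedModType R[i].

Lemma id_bounded_linear V : (id : V -> V) \in bounded_linear V V.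
Proof. by apply/bounded_linearP; split=> //; exists 1 => // x; rewrite mul1r. Qed.

Definition idop V : bop V V := Bop (id_bounded_linear V).

Lemma comp_bounded_linear U V W (g : bop V W) (f : bop U V) :
  g \o f \in bounded_linear U W.
Proof.
apply/bounded_linearP; split; first by move=> a u v /=; rewrite !linearP.
have [M M0 fM] := bop_bound f; have [N N0 gN] := bop_bound g.
exists (N * M) => [|x]; first exact: mulr_ge0.
by rewrite (le_trans (gN _)) // rmorphM -mulrA ler_wpM2l // lecR.
Qed.

Definition compop U V W (g : bop V W) (f : bop U V) : bop U W :=
  Bop (comp_bounded_linear g f).

Lemma adjoint_bounded_linear V (T : bop V V) :
  (fun phi : dual V => compop phi T : dual V) \in
    bounded_linear (dual V) (dual V).
Proof.
apply/bounded_linearP; split; first by move=> a phi psi; exact: bopP.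
have [M M0 TM] := bop_bound T; exists M => // phi.
rewrite -rmorphM lecR; apply: opnorm_le => [|x].
  by rewrite mulr_ge0 // opnorm_ge0.
rewrite (le_trans (ler_opnorm phi (T x))) // [M * _]mulrC rmorphM -mulrA.
by rewrite ler_wpM2l // lecR opnorm_ge0.
Qed.

Definition adjoint V (T : bop V V) : bop (dual V) (dual V) :=
  Bop (adjoint_bounded_linear T).

(* The library norm of a pair is the maximum of the norms; any of the usual
   norms on the direct sum is equivalent to it. *)
Lemma prod_norm_le V W (p : (V * W : normedModType _)%type) (e : R[i]) :
  (`|p| <= e) = (`|p.1| <= e) && (`|p.2| <= e).
Proof.
by rewrite {1}/Num.norm /= comparable_ge_max // real_comparable ?ger0_real.
Qed.

Lemma optri_bounded_linear V (A C B : bop V V) :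
  (fun p => (A p.1 + C p.2, B p.2)) \in
    bounded_linear (V * V)%type (V * V)%type.
Proof.
apply/bounded_linearP; split.
  move=> a p q; rewrite /= !linearP; congr pair => /=.
  by rewrite scalerDr addrACA.
have [M M0 AM] := bop_bound A; have [N N0 CN] := bop_bound C.
have [L L0 BL] := bop_bound B.
exists (M + N + L) => [|p]; first by rewrite !addr_ge0.
have /andP[p1 p2] : (`|p.1| <= `|p|) && (`|p.2| <= `|p|).
  by rewrite -prod_norm_le.
have le (K : R) (x : V) : 0 <= K -> `|x| <= `|p| ->
    K%:C * `|x| <= K%:C * `|p|.
  by move=> K0; apply: ler_wpM2l; rewrite lecR.
have ge0 (K : R) : 0 <= K -> 0 <= K%:C * `|p|.
  by move=> K0; rewrite mulr_ge0 // lecR.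
rewrite prod_norm_le /= !rmorphD !mulrDl; apply/andP; split.
  rewrite (le_trans (ler_normD _ _)) // ler_wpDr ?ge0 // lerD //.
    exact: le_trans (AM _) (le _ _ _ _).
  exact: le_trans (CN _) (le _ _ _ _).
rewrite ler_wpDl ?addr_ge0 ?ge0 //.
exact: le_trans (BL _) (le _ _ _ _).
Qed.

Definition optri V (A C B : bop V V) : bop (V * V)%type (V * V)%type :=
  Bop (optri_bounded_linear A C B).

Lemma opdiag_bounded_linear V (A B : bop V V) :
  (fun p => (A p.1, B p.2)) \in bounded_linear (V * V)%type (V * V)%type.
Proof.
have -> : (fun p => (A p.1, B p.2)) = optri A 0 B.
  by apply/funext => p; congr pair; rewrite /= addr0.
exact: valP (optri A 0 B).
Qed.

Definition opdiag V (A B : bop V V) : bop (V * V)%type (V * V)%type :=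
  Bop (opdiag_bounded_linear A B).

End Operators.

Section BrowderSpectrum.
Variables (R : realType) (V : normedModType R[i]).
Implicit Types (T : bop V V) (l : R[i]).

(* For subspaces W `<=` U of V: finitely many classes span the quotient U / W. *)
Definition finite_dim_quotient (U W : set V) : Prop :=
  exists (n : nat) (v : 'I_n -> V), (forall i, U (v i)) /\
    forall u, U u -> exists a : 'I_n -> R[i], W (u - \sum_(i < n) a i *: v i).

Definition fredholm_at T l : Prop :=
  let S := T - l *: idop V in
  [/\ closed (range S),
      finite_dim_quotient [set x | S x = 0] [set 0] &
      finite_dim_quotient setT (range S)].

Definition is_ascent T (n : nat) : Prop :=
  let stable k := [set x | iter k T x = 0] = [set x | iter k.+1 T x = 0] in
  stable n /\ forall k, stable k -> (n <= k)%N.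

Definition is_descent T (n : nat) : Prop :=
  let stable k := range (iter k T) = range (iter k.+1 T) in
  stable n /\ forall k, stable k -> (n <= k)%N.

Definition browder_at T l : Prop :=
  fredholm_at T l /\
  exists n, is_ascent (T - l *: idop V) n /\ is_descent (T - l *: idop V) n.

Definition browder_spectrum T : set R[i] := [set l | ~ browder_at T l].

Definition disc (z : R[i]) (r : R) : set R[i] := [set w | `|w - z| < r%:C].

(* f is total, but only its values near points of D matter when D is open. *)
Definition analytic_on (D : set R[i]) (f : R[i] -> V) : Prop :=
  forall z, D z -> exists (r : R) (c : nat -> V), 0 < r /\
    forall w, disc z r w ->
      series (fun n => (w - z) ^+ n *: c n) @ \oo --> f w.

Definition has_SVEP_at T (l0 : R[i]) : Prop :=
  forall r : R, 0 < r -> forall f : R[i] -> V, analytic_on (disc l0 r) f ->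
    (forall l, disc l0 r l -> (T - l *: idop V) (f l) = 0) ->
    forall l, disc l0 r l -> f l = 0.

Definition Xi T : set R[i] := [set l | ~ has_SVEP_at T l].

End BrowderSpectrum.

(* Main.v *)
(* Algebraically, l is not in the Browder spectrum of T iff S = T - l has a
   Fitting decomposition: for some n the space is ker S^n (+) ran S^n with
   ker S^n finite-dimensional; on a Banach space S then has a bounded Drazin
   inverse. Let M = M_C - l be such, with Drazin inverse N and spectral
   projection P, and write A, B for A - l, B - l. If B^n kills y, then M^n (0, y)
   lies in X (+) 0; hence A and B have Fitting decompositions as soon as A has
   finite descent, and this holds when the second component of N^n (x, 0) lies
   in pr2 (ker M^n) for all x. Were it not so, the maps pr2 M^n N^i (., 0) and
   h pr2 N^j (., 0), with h a functional vanishing on pr2 (ker M^n), would give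
   backward orbits of B and of the adjoint of A that start in the kernel; the
   generating functions of such orbits, obtained from the resolvent
   (1 - m N)^-1, are analytic null solutions contradicting both single-valued
   extension properties. Conversely finite ascent of B - l forces SVEP at l, by
   comparing power series coefficients and the identity theorem. *)
From HB Require Import structures.
From mathcomp Require Import all_boot all_order all_algebra.
From mathcomp Require Import complex lra ring.
From mathcomp Require Import boolp classical_sets functions reals topology.
From mathcomp Require Import tvs normedtype sequences.
Require Import Defs.

Set Implicit Arguments.
Unset Strict Implicit.
Unset Printing Implicit Defensive.

Import Order.TTheory GRing.Theory Num.Theory.
Import numFieldNormedType.Exports.

Local Open Scope classical_set_scope.
Local Open Scope complex_scope.
Local Open Scope ring_scope.

(** * Real-valued norms and completeness *)

Section RealNorm.
Variable R : realType.
Implicit Types V W : normedModType R[i].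

(** Norms over [R[i]] are themselves elements of [R[i]]; the real part moves all estimates to [R],
    where [lra], minima and suprema apply. *)
Definition nrm V (x : V) : R := complex.Re `|x|.

Lemma nrmE V (x : V) : `|x| = (nrm x)%:C.
Proof.
have := normr_ge0 x; rewrite lecE => /andP[/eqP + _].
by rewrite /nrm; case: `|x| => a b /= ->.
Qed.

Lemma nrm_ge0 V (x : V) : 0 <= nrm x.
Proof. by rewrite -lecR -nrmE normr_ge0. Qed.

Lemma nrm0 V : nrm (0 : V) = 0.
Proof. by rewrite /nrm normr0. Qed.

Lemma nrm_gt0 V (x : V) : x != 0 -> 0 < nrm x.
Proof. by rewrite -normr_gt0 nrmE ltcR. Qed.

Lemma nrm_le0 V (x : V) : nrm x <= 0 -> x = 0.
Proof. by rewrite -lecR -nrmE normr_le0 => /eqP. Qed.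

Lemma nrmN V (x : V) : nrm (- x) = nrm x.
Proof. by rewrite /nrm normrN. Qed.

Lemma nrmBC V (x y : V) : nrm (x - y) = nrm (y - x).
Proof. by rewrite -nrmN opprB. Qed.

Lemma nrmD V (x y : V) : nrm (x + y) <= nrm x + nrm y.
Proof. by rewrite -lecR rmorphD /= -!nrmE ler_normD. Qed.

Lemma nrmB V (x y : V) : nrm (x - y) <= nrm x + nrm y.
Proof. by rewrite (le_trans (nrmD _ _)) ?nrmN. Qed.

Lemma nrmZ V (a : R[i]) (x : V) : nrm (a *: x) = nrm (a : R[i]^o) * nrm x.
Proof.
apply: complexI; rewrite rmorphM /= -!nrmE normrZ; congr (_ * _).
Qed.

Lemma nrmZr V (t : R) (x : V) : nrm (t%:C *: x) = `|t| * nrm x.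
Proof. by rewrite nrmZ /nrm normc_def /= expr0n addr0 sqrtr_sqr. Qed.

Lemma nrmM (a b : R[i]) : nrm (a * b : R[i]^o) = nrm (a : R[i]^o) * nrm (b : R[i]^o).
Proof. exact: (nrmZ a (b : R[i]^o)). Qed.

Lemma nrmX (a : R[i]) n : nrm (a ^+ n : R[i]^o) = nrm (a : R[i]^o) ^+ n.
Proof.
elim: n => [|n IH]; last by rewrite !exprS nrmM IH.
by rewrite !expr0 /nrm normr1.
Qed.

Lemma nrm_real (t : R) : nrm (t%:C : R[i]^o) = `|t|.
Proof. by rewrite /nrm normc_def /= expr0n addr0 sqrtr_sqr. Qed.

Lemma nrm_le V (x : V) (M : R) : (`|x| <= M%:C) = (nrm x <= M).
Proof. by rewrite nrmE lecR. Qed.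

Lemma nrm_lt V (x : V) (M : R) : (`|x| < M%:C) = (nrm x < M).
Proof. by rewrite nrmE ltcR. Qed.

Lemma nrm_bounded_linear V W (f : V -> W) (M : R) : linear f ->
  (forall x, nrm (f x) <= M * nrm x) -> f \in bounded_linear V W.
Proof.
move=> lf fM; rewrite inE; split=> //; exists M%:C => x.
by rewrite !nrmE -rmorphM lecR.
Qed.

Lemma bop_nrm_le V W (f : bop V W) (M : R) : 0 <= M ->
  (forall x, nrm (f x) <= M * nrm x) -> nrm f <= M.
Proof.
move=> M0 fM; apply: opnorm_le => // x.
by rewrite !nrmE -rmorphM lecR.
Qed.

Lemma nrm_bop V W (f : bop V W) (x : V) : nrm (f x) <= nrm f * nrm x.
Proof. by rewrite -lecR rmorphM /= -!nrmE ler_opnorm. Qed.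

Lemma nrm_prodE V W (p : (V * W : normedModType _)%type) (M : R) :
  (nrm p <= M) = (nrm p.1 <= M) && (nrm p.2 <= M).
Proof. by rewrite -!nrm_le prod_norm_le. Qed.

Lemma cvg_nrmP V (u : nat -> V) (l : V) :
  u @ \oo --> l <->
  forall e : R, 0 < e -> exists N, forall n, (N <= n)%N -> nrm (l - u n) < e.
Proof.
split=> [/cvgrPdist_lt ul e e0|ul].
  have e0C : 0 < e%:C by rewrite ltcR.
  have [N _ uN] := ul _ e0C; exists N => n Nn.
  by have := uN _ Nn; rewrite /= nrm_lt.
apply/cvgrPdist_lt => e e0.
have eE : e = (complex.Re e)%:C.
  by move: e0; rewrite ltcE => /andP[/eqP + _]; case: (e) => a b /= ->.
move: e0; rewrite eE ltcR => /ul[N uN].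
by exists N => // n /= /uN; rewrite nrm_lt.
Qed.

Lemma half_pow_lt (e C : R) : 0 < e -> 0 <= C ->
  exists N, forall n, (N <= n)%N -> C / 2 ^+ n < e.
Proof.
move=> e0 C0; pose N := Num.truncn (C / e); exists N => n Nn.
rewrite ltr_pdivrMr ?exprn_gt0//.
have : C / e < n.+1%:R.
  rewrite (lt_le_trans (truncnS_gt _))// ler_nat ltnS //.
rewrite ltr_pdivrMr // mulrC => /lt_le_trans; apply.
rewrite ler_pM2l // -natrX ler_nat; exact: ltn_expl.
Qed.

Lemma cvg_half_pow V (u : nat -> V) (l : V) (C : R) :
  (forall n, nrm (l - u n) <= C / 2 ^+ n) -> u @ \oo --> l.
Proof.
move=> uC; apply/cvg_nrmP => e e0.
have C0 : 0 <= C by have := le_trans (nrm_ge0 _) (uC 0%N); rewrite expr0 divr1.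
have [N eN] := half_pow_lt e0 C0.
by exists N => n /eN; exact: le_lt_trans.
Qed.

(** Geometric increments make the sequence Cauchy. The explicit rate is what the nested balls and
    the successive approximations below rely on. *)
Lemma complete_half_pow (V : completeNormedModType R[i]) (u : nat -> V) (C : R) :
  (forall n, nrm (u n.+1 - u n) <= C / 2 ^+ n) ->
  exists l, forall n, nrm (l - u n) <= 2 * C / 2 ^+ n.
Proof.
move=> uC.
have C0 : 0 <= C by have := le_trans (nrm_ge0 _) (uC 0%N); rewrite expr0 divr1.
(* The bound is the exact partial geometric sum, so the induction closes with equality. *)
have dist n k : nrm (u (n + k)%N - u n) <= 2 * C / 2 ^+ n * (1 - 1 / 2 ^+ k).
  elim: k => [|k IH]; first by rewrite addn0 subrr nrm0 expr0 divr1 subrr mulr0.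
  rewrite addnS -(subrKA (u (n + k)%N)) (le_trans (nrmD _ _)) //.
  rewrite (le_trans (lerD (uC _) IH)) //.
  rewrite exprS exprD le_eqVlt; apply/orP; left; apply/eqP; field.
  by rewrite !expf_eq0 pnatr_eq0 !andbF.
have dist' n m : (n <= m)%N -> nrm (u m - u n) <= 2 * C / 2 ^+ n.
  move=> nm; rewrite -(subnKC nm) (le_trans (dist _ _)) //.
  rewrite ler_piMr ?divr_ge0 ?mulr_ge0 ?exprn_ge0 //.
  by rewrite lerBlDr lerDl divr_ge0 ?exprn_ge0.
have : cvg (u @ \oo).
  apply: cauchy_cvg; apply/cauchy_exP => e e0.
  have eE : e = (complex.Re e)%:C.
    by move: e0; rewrite ltcE => /andP[/eqP + _]; case: (e) => a b /= ->.
  move: e0; rewrite eE ltcR => e0.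
  have [N eN] := half_pow_lt e0 (mulr_ge0 (ler0n R 2) C0).
  exists (u N); exists N => // n /= Nn.
  rewrite -ball_normE /= nrm_lt nrmBC (le_lt_trans (dist' _ _ Nn)) //.
  exact: eN.
move=> /cvg_ex[l /cvg_nrmP ul]; exists l => n.
apply/ler_addgt0Pr => e /ul[N uN].
have := uN _ (leq_maxr n N) => /ltW; have := dist' _ _ (leq_maxl n N).
move=> h1 h2; rewrite -(subrKA (u (maxn n N))) (le_trans (nrmD _ _)) //.
by rewrite addrC lerD.
Qed.

End RealNorm.

(** * Hahn-Banach *)

Section HahnBanach.
Variables (R : realType) (V : normedModType R[i]).
Implicit Types p q f : V -> R.

Definition sublinear p :=
  (forall x y, p (x + y) <= p x + p y) /\
  (forall (t : R) x, 0 < t -> p (t%:C *: x) <= t * p x).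

Lemma sublinear0 p : sublinear p -> p 0 = 0.
Proof.
move=> [_ ph]; have h2 : p 0 <= 2 * p 0.
  by have := ph 2 0; rewrite scaler0; apply.
have h1 : p 0 <= 2^-1 * p 0.
  by have := ph 2^-1 0; rewrite scaler0; apply; rewrite invr_gt0.
lra.
Qed.

Lemma sublinearN p : sublinear p -> forall x, - p (- x) <= p x.
Proof.
move=> sp x; have := sp.1 x (- x).
by rewrite subrr (sublinear0 sp) lerNl => h; lra.
Qed.

Lemma sublinearZ p : sublinear p ->
  forall (t : R) x, 0 < t -> p (t%:C *: x) = t * p x.
Proof.
move=> sp t x t0; apply/eqP; rewrite eq_le sp.2 //=.
have ti0 : 0 < t^-1 by rewrite invr_gt0.
have := sp.2 _ (t%:C *: x) ti0.
rewrite scalerA -rmorphM /= mulVf ?gt_eqF // scale1r.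
by rewrite ler_pdivlMl.
Qed.

(* The witness is v |-> inf {p (v + t x) - t a : t >= 0}. *)
Lemma sublinear_ray p x (a : R) : sublinear p -> a <= p x ->
  exists q, [/\ sublinear q, forall v, q v <= p v &
    forall v, q v <= p (v + x) - a].
Proof.
move=> sp ap.
pose A v := [set r | exists2 t : R, 0 <= t & r = p (v + t%:C *: x) - t * a].
have A0 v : A v !=set0.
  by exists (p (v + 0%:C *: x) - 0 * a); exists 0.
have Alb v : lbound (A v) (- p (- v)).
  move=> _ [t t0 ->].
  have h1 : p (t%:C *: x) <= p (v + t%:C *: x) + p (- v).
    by have := sp.1 (v + t%:C *: x) (- v); rewrite addrAC subrr add0r.
  have h2 : t * a <= p (t%:C *: x).
    move: t0; rewrite le_eqVlt => /orP[/eqP <-|t0].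
      by rewrite mul0r scale0r (sublinear0 sp).
    by rewrite (sublinearZ sp) // ler_pM2l.
  lra.
have hA v : has_inf (A v) by split=> //; exists (- p (- v)).
have qle v t : 0 <= t -> inf (A v) <= p (v + t%:C *: x) - t * a.
  by move=> t0; apply: ge_inf; [exact: (hA v).2|exists t].
exists (fun v => inf (A v)); split.
- split=> [v w|t v t0].
    apply/ler_addgt0Pr => e e0; have e2 : 0 < e / 2 by lra.
    have [_ [t t0 ->] ht] := inf_adherent e2 (hA v).
    have [_ [s s0 ->] hs] := inf_adherent e2 (hA w).
    have := qle (v + w) (t + s) (addr_ge0 t0 s0).
    have := sp.1 (v + t%:C *: x) (w + s%:C *: x).
    rewrite addrACA -scalerDl -rmorphD /= => h1 h2.
    rewrite (le_trans h2) // mulrDl; lra.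
  rewrite -ler_pdivrMl //; apply: lb_le_inf => // _ [s s0 ->].
  rewrite ler_pdivrMl //.
  have := qle (t%:C *: v) (t * s) (mulr_ge0 (ltW t0) s0).
  rewrite rmorphM /= -scalerA -scalerDr (sublinearZ sp) //.
  by rewrite mulrBr mulrA.
- by move=> v; have := qle v 0 (lexx 0); rewrite scale0r addr0 mul0r subr0.
- by move=> v; have := qle v 1 ler01; rewrite scale1r mul1r.
Qed.

(* Zorn's lemma is applied to everywhere defined sublinear functionals: the
   minimal ones are linear, so no partially defined functional is needed. *)
Lemma sublinear_minorant p0 : sublinear p0 ->
  exists p, [/\ sublinear p, forall v, p v <= p0 v &
    forall q, sublinear q -> (forall v, q v <= p v) -> q = p].
Proof.
move=> sp0.
pose P : set (V -> R) := [set p | sublinear p /\ forall v, p v <= p0 v].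
have Pp0 : P p0 by [].
pose T := {p : V -> R | P p}.
(* The order is reversed: a maximal element for Zorn is a minimal functional, and the upper bound of
   a chain is its pointwise infimum. *)
pose le (p q : T) := `[< forall v, sval q v <= sval p v >].
have [| | | |[p [sp pp0]] pmin] := @Zorn T le.
- by move=> p; apply/asboolP.
- move=> r s t /asboolP rs /asboolP st; apply/asboolP => v.
  exact: le_trans (st v) (rs v).
- move=> [s Ps] [t Pt] /asboolP /= st /asboolP /= ts; apply: eq_exist.
  by apply/funext => v; apply/eqP; rewrite eq_le st ts.
- move=> A Atot; have [[a Aa]|A0] := pselect (A !=set0); last first.
    by exists (exist _ p0 Pp0) => s As; exfalso; apply: A0; exists s.
  pose B v := [set sval p v | p in A].
  have B0 v : B v !=set0 by exists (sval a v), a.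
  have Blb v : lbound (B v) (- p0 (- v)).
    move=> _ [[p [sp pp0]] _ <-] /=; have := sublinearN sp v.
    by apply: le_trans; rewrite lerN2.
  have hB v : has_inf (B v) by split=> //; exists (- p0 (- v)).
  have qle v (s : T) : A s -> inf (B v) <= sval s v.
    by move=> As; apply: ge_inf; [exact: (hB v).2|exists s].
  have Pq : P (fun v => inf (B v)).
    split; last first.
      by move=> v; rewrite (le_trans (qle v a Aa)) //; exact: (svalP a).2.
    split=> [v w|t v t0].
      apply/ler_addgt0Pr => e e0; have e2 : 0 < e / 2 by lra.
      have [_ [p Ap <-] hp] := inf_adherent e2 (hB v).
      have [_ [q Aq <-] hq] := inf_adherent e2 (hB w).
      have [r [Ar rp rq]] : exists r : T, [/\ A r,
          (forall v, sval r v <= sval p v) & forall v, sval r v <= sval q v].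
        by have [/asboolP h|/asboolP h] := Atot _ _ Ap Aq; [exists q|exists p].
      have := qle (v + w) r Ar; have := (svalP r).1.1 v w.
      have := rp v; have := rq w; lra.
    rewrite -ler_pdivrMl //; apply: lb_le_inf => // _ [p Ap <-].
    rewrite ler_pdivrMl // (le_trans (qle _ p Ap)) //.
    exact: (svalP p).1.2.
  exists (exist _ _ Pq) => s As; apply/asboolP => v /=; exact: qle.
exists p; split=> // q sq qp.
have Pq : P q by split=> // v; exact: le_trans (qp v) (pp0 v).
have : exist P q Pq = exist P p (conj sp pp0) by apply: pmin; apply/asboolP.
by move=> [].
Qed.

(** Lowering [p] along the ray of [y] with slope [p y] must give [p] back by minimality, and this is
    the missing inequality [p x + p y <= p (x + y)]. *)
Lemma minimal_sublinear_linear p : sublinear p ->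
  (forall q, sublinear q -> (forall v, q v <= p v) -> q = p) ->
  (forall x y, p (x + y) = p x + p y) /\
  (forall (t : R) x, p (t%:C *: x) = t * p x).
Proof.
move=> sp pmin.
have pD x y : p (x + y) = p x + p y.
  apply/eqP; rewrite eq_le sp.1 /=.
  have [q [sq qp qx]] := sublinear_ray sp (lexx (p y)).
  by have := qx x; rewrite (pmin _ sq qp) lerBrDr.
have pN x : p (- x) = - p x.
  by have := pD x (- x); rewrite subrr (sublinear0 sp); lra.
split=> // t x; have [t0|t0|->] := ltrgt0P t.
- exact: (sublinearZ sp).
- rewrite -[t]opprK rmorphN /= scaleNr pN (sublinearZ sp) ?oppr_gt0 //.
  by ring.
- by rewrite scale0r mul0r (sublinear0 sp).
Qed.

Lemma dual_separates (y : V) : y != 0 ->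
  exists h : dual V, h y = 1.
Proof.
move=> y0.
have sn : sublinear (@nrm R V).
  split=> [u v|t x t0]; first exact: nrmD.
  by rewrite nrmZr gtr0_norm.
(* Lowering the norm first forces [p1 (- y) <= - nrm y], so every linear minorant of [p1] is at
   least [nrm y] at [y]. *)
have [p1 [sp1 p1n p1y]] := sublinear_ray sn (lexx (nrm y)).
have [f [sf fp1 fmin]] := sublinear_minorant sp1.
have [fD fZ] := minimal_sublinear_linear sf fmin.
have fle v : f v <= nrm v by rewrite (le_trans (fp1 v)).
have fN v : f (- v) = - f v.
  by have := fD v (- v); rewrite subrr (sublinear0 sf); lra.
have fabs v : `|f v| <= nrm v.
  by rewrite ler_norml fle lerNl -fN -nrmN fle.
have fy : nrm y <= f y.
  have := le_trans (fp1 (- y)) (p1y (- y)).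
  by rewrite addNr nrm0 fN; lra.
(* This is the complex-linear functional whose real part is [f]. *)
pose h x : R[i]^o := f x -i* f ('i *: x).
have hlin : linear h.
  move=> [a b] u v; rewrite /h.
  have -> : a +i* b = a%:C + 'i * b%:C :> R[i] by simpc.
  rewrite !(scalerDr, scalerDl) !fD.
  have -> w : ('i * b%:C) *: w = b%:C *: ('i *: w) by rewrite scalerA mulrC.
  have -> w : 'i *: (a%:C *: w) = a%:C *: ('i *: w) by rewrite !scalerA mulrC.
  have -> w : 'i *: (b%:C *: ('i *: w)) = (- b)%:C *: w.
    rewrite !scalerA; congr (_ *: _).
    by rewrite mulrAC -expr2 sqr_i mulN1r rmorphN.
  rewrite !fZ /GRing.scale /=; apply/eqP; rewrite eq_complex /=.
  by apply/andP; split; apply/eqP => /=; ring.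
have hbnd x : nrm (h x) <= 2 * nrm x.
  have -> : h x = (f x)%:C *: (1 : R[i]^o) - (f ('i *: x))%:C *: ('i : R[i]^o).
    rewrite /h /GRing.scale /=; apply/eqP; rewrite eq_complex /=.
    by apply/andP; split; apply/eqP => /=; ring.
  rewrite (le_trans (nrmB _ _)) // !nrmZr.
  have -> : nrm (1 : R[i]^o) = 1 by rewrite /nrm normr1.
  have ni : nrm ('i : R[i]^o) = 1.
    by rewrite /nrm normc_def /= expr0n expr1n add0r sqrtr1.
  rewrite ni !mulr1 mulr_natl mulr2n lerD //.
  by rewrite (le_trans (fabs _)) // nrmZ ni mul1r.
pose H : bop V R[i]^o := Bop (nrm_bounded_linear hlin hbnd).
have Hy : H y != 0.
  apply/negP => /eqP hy.
  have : complex.Re (h y) = 0 by rewrite -[h y]/(H y) hy.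
  by rewrite /h /= => fy0; move: fy; rewrite fy0 leNgt nrm_gt0.
exists ((H y : R[i])^-1 *: H).
have -> : ((H y : R[i])^-1 *: H : bop _ _) y = (H y : R[i])^-1 *: H y by [].
by rewrite /GRing.scale /= mulVf.
Qed.

End HahnBanach.

(** * Open mapping theorem *)

Section OpenMapping.
Variable R : realType.

Lemma half_pow_le0 (x C : R) : (forall n, x <= C / 2 ^+ n) -> x <= 0.
Proof.
move=> xC; rewrite leNgt; apply/negP => x0.
have C0 : 0 <= C by have := xC 0%N; rewrite expr0 divr1; lra.
have [N /(_ N (leqnn N))] := half_pow_lt x0 C0.
by rewrite ltNge xC.
Qed.

(** Baire's argument by hand: otherwise one chooses nested balls, the one of stage [n] avoiding the
    image of the ball of radius [n]. A preimage of the common point of these balls has norm at most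
    some [n], a contradiction. *)
Lemma open_mapping_approx (E F : completeNormedModType R[i]) (G : bop E F) :
  (forall y, exists x, G x = y) ->
  exists (n : nat) y0 (r : R), 0 < r /\ forall y, nrm (y - y0) < r ->
    forall s : R, 0 < s -> exists2 x, nrm x <= n%:R & nrm (y - G x) < s.
Proof.
move=> Gsurj; apply: contrapT => Hno.
have step (np : nat * (F * R)) : exists q : F * R, 0 < np.2.2 ->
    [/\ 0 < q.2, q.2 <= np.2.2 / 2, nrm (q.1 - np.2.1) + q.2 <= np.2.2 &
      forall x, nrm x <= np.1%:R -> q.2 < nrm (q.1 - G x)].
  case: np => n [y0 r] /=; have [r0|r0] := pselect (0 < r); last first.
    by exists (y0, r) => /r0.
  apply: contrapT => Hq; apply: Hno; exists n, y0, r; split=> // y yr s s0.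
  apply: contrapT => Hx; apply: Hq.
  (* The three terms keep the new ball inside the old one, keep its radius below the distance [s] to
     the image, and halve the radius. *)
  pose r1 := Num.min (Num.min ((r - nrm (y - y0)) / 2) (s / 2)) (r / 2).
  have r1r : r1 <= r / 2 by rewrite ge_min lexx orbT.
  have r1s : r1 <= s / 2 by rewrite !ge_min lexx orbT.
  have r1y : r1 <= (r - nrm (y - y0)) / 2 by rewrite !ge_min lexx.
  have r10 : 0 < r1 by rewrite !lt_min; lra.
  exists (y, r1) => /= _; split=> // [|x xn]; first by lra.
  rewrite ltNge; apply/negP => yG; apply: Hx; exists x => //; lra.
have [f fP] := choice step.
pose fix b n : F * R := if n is k.+1 then f (k, b k) else (0, 1).
have b0 n : 0 < (b n).2.
  by elim: n => [|n IH] //=; have [] := fP (n, b n) IH.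
have b_half n : (b n).2 <= 1 / 2 ^+ n.
  elim: n => [|n IH]; first by rewrite expr0 divr1.
  have [_ /= + _ _] := fP (n, b n) (b0 n).
  rewrite exprS invfM; lra.
have b_dist n m : (n <= m)%N -> nrm ((b m).1 - (b n).1) + (b m).2 <= (b n).2.
  move=> nm; rewrite -(subnKC nm); elim: (m - n)%N => [|k IH].
    by rewrite addn0 subrr nrm0 add0r.
  have [_ _ /= + _] := fP ((n + k)%N, b (n + k)%N) (b0 _).
  rewrite addnS /=.
  have := nrmD (f ((n + k)%N, b (n + k)%N)).1 (- (b (n + k)%N).1).
  have := nrmD ((f ((n + k)%N, b (n + k)%N)).1 - (b (n + k)%N).1)
     ((b (n + k)%N).1 - (b n).1).
  rewrite subrKA; lra.
have [l lP] : exists l, forall n, nrm (l - (b n).1) <= 2 * 1 / 2 ^+ n.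
  apply: complete_half_pow => n; have := b_dist n n.+1 (leqnSn n).
  have := b0 n.+1; have := b_half n; lra.
have lb n : nrm (l - (b n).1) <= (b n).2.
  rewrite -subr_le0; apply: (@half_pow_le0 _ 2) => k.
  have := lP (n + k)%N; have := b_dist n (n + k)%N (leq_addr k n).
  have := nrmD (l - (b (n + k)%N).1) ((b (n + k)%N).1 - (b n).1).
  rewrite subrKA mulr1 => h1 h2 h3.
  have : 2 / 2 ^+ (n + k) <= 2 / 2 ^+ k :> R.
    rewrite ler_pM2l // lef_pV2 ?posrE ?exprn_gt0 // ler_weXn2l ?ler1n //.
    exact: leq_addl.
  have := b0 (n + k)%N; lra.
have [x Gx] := Gsurj l.
pose n := (Num.truncn (nrm x)).+1.
have [_ _ _ /= /(_ x)] := fP (n, b n) (b0 n).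
rewrite Gx -/(b n.+1) nrmBC => /(_ (ltW (truncnS_gt _))).
by rewrite ltNge (lb n.+1).
Qed.

Lemma open_mapping (E F : completeNormedModType R[i]) (G : bop E F) :
  (forall y, exists x, G x = y) ->
  exists2 K : R, 0 <= K &
    forall y, exists2 x, G x = y & nrm x <= K * nrm y.
Proof.
move=> /open_mapping_approx[n [y0 [r [r0 approx]]]].
pose K : R := 4 * n%:R / r.
have K0 : 0 <= K by rewrite divr_ge0 ?mulr_ge0 // ltW.
(* One correction halves the error. The scale [t] gives [t w] norm [r / 2]; approximating [y0 + t w]
   and [y0] within [s] each and subtracting leaves an error of at most [2 s = t * nrm w / 2], which
   is then divided by [t]. Iterating and summing the corrections gives an exact preimage. *)
have half w : exists x, nrm x <= K * nrm w /\ nrm (w - G x) <= nrm w / 2.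
  have [->|w0] := eqVneq w 0.
    by exists 0; rewrite (linear0 G) subrr !nrm0 mulr0 mul0r lexx.
  have nw : 0 < nrm w by exact: nrm_gt0.
  pose t := r / (2 * nrm w); have t0 : 0 < t by rewrite /t divr_gt0 ?mulr_gt0.
  pose s := t * nrm w / 4; have s0 : 0 < s by rewrite divr_gt0 //; exact: mulr_gt0.
  have [|x1 x1n x1s] := approx (y0 + t%:C *: w) _ s s0.
    rewrite addrAC subrr add0r nrmZr gtr0_norm // /t.
    have -> : r / (2 * nrm w) * nrm w = r / 2.
      by field; rewrite gt_eqF.
    by rewrite ltr_pdivrMr // mulr_natr mulr2n ltrDr.
  have [|x2 x2n x2s] := approx y0 _ s s0; first by rewrite subrr nrm0.
  exists (t^-1%:C *: (x1 - x2)); split.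
    rewrite nrmZr gtr0_norm ?invr_gt0 // ler_pdivrMl //.
    have -> : t * (K * nrm w) = 2 * n%:R.
      by rewrite /t /K; field; rewrite !gt_eqF.
    by have := nrmB x1 x2; lra.
  have -> : w - G (t^-1%:C *: (x1 - x2)) =
     t^-1%:C *: ((y0 + t%:C *: w - G x1) - (y0 - G x2)).
    have -> (a b c d : F) : a + b - c - (a - d) = b - (c - d).
      rewrite -[a + b - c]addrA [a + (b - c)]addrC !opprB addrA.
      by rewrite [_ + d]addrAC addrK addrAC addrA.
    rewrite [RHS]scalerBr scalerA -rmorphM /= mulVf ?gt_eqF // scale1r.
    by rewrite linearZ linearB.
  rewrite nrmZr gtr0_norm ?invr_gt0 // ler_pdivrMl //.
  rewrite (le_trans (nrmB _ _)) //.
  by rewrite (le_trans (ltW (ltrD x1s x2s))) // /s; lra.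
have [g gP] := choice half.
exists (2 * K) => [|w]; first by rewrite mulr_ge0.
pose e w := w - G (g w).
have en k : nrm (iter k e w) <= nrm w / 2 ^+ k.
  elim: k => [|k IH]; first by rewrite expr0 divr1.
  have := (gP (iter k e w)).2.
  rewrite iterS exprS invfM -/(e _); lra.
pose a := series (fun k => g (iter k e w)).
have aS k : a k.+1 = a k + g (iter k e w) by rewrite /a /series /= big_nat_recr.
have [l lP] : exists l, forall k, nrm (l - a k) <= 2 * (K * nrm w) / 2 ^+ k.
  apply: complete_half_pow => k; rewrite aS addrAC subrr add0r.
  by rewrite (le_trans (gP _).1) // -mulrA ler_wpM2l.
have Ga k : w - G (a k) = iter k e w.
  elim: k => [|k IH]; first by rewrite /a /series /= big_geq // linear0 subr0.
  by rewrite aS linearD opprD addrA IH.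
exists l; last first.
  by have := lP 0%N; rewrite /a /series /= big_geq // subr0 expr0 divr1 mulrA.
apply/eqP; rewrite eq_sym -subr_eq0; apply/eqP/nrm_le0.
apply: (@half_pow_le0 _ (nrm w + nrm G * (2 * (K * nrm w)))) => k.
rewrite -(subrKA (G (a k))) (le_trans (nrmD _ _)) // mulrDl Ga lerD //.
rewrite nrmBC -linearB (le_trans (nrm_bop _ _)) // -mulrA.
by rewrite ler_wpM2l ?nrm_ge0.
Qed.

Lemma bounded_inverse (E F : completeNormedModType R[i]) (G : bop E F) :
  (forall y, exists x, G x = y) -> (forall x, G x = 0 -> x = 0) ->
  exists2 H : bop F E, cancel H G & cancel G H.
Proof.
move=> Gsurj Ginj.
have {}Ginj x y : G x = G y -> x = y.
  move=> Gxy; apply/eqP; rewrite -subr_eq0; apply/eqP/Ginj.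
  by rewrite linearB /= Gxy subrr.
have [K K0] := open_mapping Gsurj.
move=> KP; have {}KP y : exists x, G x = y /\ nrm x <= K * nrm y.
  by have [x] := KP y; exists x.
have [h hP] := choice KP.
have hlin : linear h.
  move=> a u v; apply: Ginj; rewrite (linearP G) /= (hP u).1 (hP v).1.
  exact: (hP _).1.
exists (Bop (nrm_bounded_linear hlin (fun y => (hP y).2))) => [y|x].
  exact: (hP y).1.
by apply: Ginj; exact: (hP _).1.
Qed.

(** The solution of [y - T y = x] is the limit of the iterates from 0 of the contraction sending [y]
    to [x + T y]; the ratio 1/2 gives the bound 2. *)
Lemma neumann_inverse (E : completeNormedModType R[i]) (T : bop E E) :
  nrm T <= 1 / 2 ->
  exists H : bop E E, [/\ forall x, H x - T (H x) = x,
    forall x, H (x - T x) = x & nrm H <= 2].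
Proof.
move=> T2.
have Tle x : nrm (T x) <= nrm x / 2.
  rewrite (le_trans (nrm_bop _ _)) //.
  by have := ler_wpM2r (nrm_ge0 x) T2; lra.
have inj x y : x - T x = y - T y -> x = y.
  move=> xy; apply/eqP; rewrite -subr_eq0; apply/eqP/nrm_le0.
  have := Tle (x - y); have -> : T (x - y) = x - y.
    rewrite (linearB T) /=.
    have -> : T x = x - (y - T y) by rewrite -xy subKr.
    by rewrite opprB addrA addrAC addrK.
  by have := nrm_ge0 (x - y); lra.
have ex x : exists y, y - T y = x /\ nrm y <= 2 * nrm x.
  pose u n := iter n (fun y => x + T y) 0.
  have uC n : nrm (u n.+1 - u n) <= nrm x / 2 ^+ n.
    elim: n => [|n IH]; first by rewrite /u /= linear0 addr0 subr0 expr0 divr1.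
    rewrite /u iterS [in X in _ - X]iterS -/(u n.+1) -/(u n).
    rewrite addrAC opprD addNKr addrC -linearB (le_trans (Tle _)) //.
    by rewrite exprS invfM; lra.
  have [l lP] := complete_half_pow uC.
  exists l; split; last by have := lP 0%N; rewrite subr0 expr0 divr1.
  apply/eqP; rewrite -subr_eq0; apply/eqP/nrm_le0.
  apply: (@half_pow_le0 _ (2 * nrm x)) => n.
  have -> : l - T l - x = (l - u n.+1) - T (l - u n).
    rewrite (linearB T) /= /u opprD opprB [l + (- _ - _)]addrA subrKA.
    by rewrite addrAC.
  rewrite (le_trans (nrmB _ _)) //; have := Tle (l - u n).
  have := lP n; have := lP n.+1; rewrite exprS invfM.
  lra.
have [h hP] := choice ex.
have hlin : linear h.
  move=> a u v; apply: inj; rewrite (hP _).1 linearP /= opprD addrACA.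
  by rewrite -scalerBr (hP u).1 (hP v).1.
exists (Bop (nrm_bounded_linear hlin (fun x => (hP x).2))); split=> /=.
- by move=> x; rewrite (hP x).1.
- by move=> x; apply: inj; rewrite (hP _).1.
- by apply: bop_nrm_le => // x; exact: (hP x).2.
Qed.

End OpenMapping.

(** * Finite-dimensional subspaces *)

Section FiniteDimension.
Variable K : fieldType.
Implicit Types V W : lmodType K.

(** The span is defined by peeling off one multiple at a time, so that inductions on the list need
    no indexed sums. *)
Fixpoint fspan V (s : seq V) (x : V) : Prop :=
  if s is v :: s' then exists a : K, fspan s' (x - a *: v) else x = 0.

Definition subspace V (U : set V) : Prop :=
  U 0 /\ forall a u v, U u -> U v -> U (a *: u + v).

(* The spanning vectors are not required to lie in U. *)
Definition findim V (U : set V) : Prop := exists s, U `<=` fspan s.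

Lemma fspan_subspace V (s : seq V) : subspace (fspan s).
Proof.
elim: s => [|v s [IH0 IH]]; first by split=> // a u w -> ->; rewrite scaler0 addr0.
split; first by exists 0; rewrite scale0r subr0.
move=> a u w [b ub] [c wc]; exists (a * b + c).
have -> : a *: u + w - (a * b + c) *: v = a *: (u - b *: v) + (w - c *: v).
  by rewrite scalerDl scalerBr scalerA opprD addrACA.
exact: IH.
Qed.

Lemma subspaceD V (U : set V) u v : subspace U -> U u -> U v -> U (u + v).
Proof. by move=> [_ US] Uu Uv; rewrite -[u]scale1r; exact: US. Qed.

Lemma subspaceZ V (U : set V) a u : subspace U -> U u -> U (a *: u).
Proof. by move=> [U0 US] Uu; rewrite -[_ *: _]addr0; exact: US. Qed.

Lemma subspaceB V (U : set V) u v : subspace U -> U u -> U v -> U (u - v).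
Proof.
move=> US Uu Uv; apply: subspaceD => //.
by rewrite -scaleN1r; exact: subspaceZ.
Qed.

Lemma subspaceI V (U W : set V) : subspace U -> subspace W -> subspace (U `&` W).
Proof.
move=> [U0 US] [W0 WS]; split=> // a u v [Uu Wu] [Uv Wv].
by split; [exact: US|exact: WS].
Qed.

Lemma subspace_ker V W (f : {linear V -> W}) : subspace [set x | f x = 0].
Proof.
split=> [|a u v /= fu fv]; first by rewrite /= linear0.
by rewrite linearP /= fu fv scaler0 addr0.
Qed.

Lemma subspace_image V W (f : {linear V -> W}) (U : set V) :
  subspace U -> subspace (f @` U).
Proof.
move=> [U0 US]; split; first by exists 0; rewrite ?linear0.
move=> a _ _ [u Uu <-] [v Uv <-]; exists (a *: u + v); first exact: US.
by rewrite linearP.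
Qed.

Lemma fspan_mono V (U : set V) s : subspace U -> {in s, forall v, U v} ->
  fspan s `<=` U.
Proof.
move=> US; elim: s => [|v s IH] sU x /=; first by move=> ->; exact: US.1.
move=> [a /IH Ux]; rewrite -(subrK (a *: v) x).
apply: subspaceD => //; first by apply: Ux => w ws; apply: sU; rewrite inE ws orbT.
by apply: subspaceZ => //; apply: sU; rewrite inE eqxx.
Qed.

Lemma fspan_image V W (f : {linear V -> W}) s : f @` fspan s = fspan (map f s).
Proof.
apply/seteqP; split.
  move=> _ [x + <-]; elim: s x => [|v s IH] x /=; first by move=> ->; rewrite linear0.
  by move=> [a /IH]; rewrite linearB linearZ; exists a.
elim: s => [|v s IH] y /=; first by move=> ->; exists 0; rewrite ?linear0.
move=> [a /IH[x xs fx]]; exists (x + a *: v); first by exists a; rewrite addrK.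
by rewrite linearD linearZ fx subrK.
Qed.

Lemma fspan_cat V (s t : seq V) x y : fspan s x -> fspan t y -> fspan (s ++ t) (x + y).
Proof.
elim: s x => [|v s IH] x /=; first by move=> ->; rewrite add0r.
by move=> [a /IH h] /h; exists a; rewrite addrAC.
Qed.

Lemma findim_sub V (U W : set V) : U `<=` W -> findim W -> findim U.
Proof. by move=> UW [s Ws]; exists s; apply: subset_trans Ws. Qed.

Lemma findim_image V W (f : {linear V -> W}) (U : set V) :
  findim U -> findim (f @` U).
Proof.
move=> [s Us]; exists (map f s) => _ [x /Us xs <-].
by rewrite -fspan_image; exists x.
Qed.

(** Induction on the list: [U] meets the span of the tail in a space already handled, and at most
    one further vector is needed, any element of [U] with nonzero coefficient at the head.
    Independence is not claimed. *)
Lemma findim_basis V (U : set V) : subspace U -> findim U ->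
  exists2 s, {in s, forall v, U v} & U `<=` fspan s.
Proof.
move=> + [s]; elim: s U => [|v s IH] U US Us; first by exists [::].
have [t tU Ut] := IH _ (subspaceI US (fspan_subspace s)) (fun _ h => proj2 h).
have [[u [a [Uu a0 ua]]]|no] := pselect
    (exists u a, [/\ U u, a != 0 & fspan s (u - a *: v)]).
  exists (u :: t) => [w|x Ux].
    by rewrite inE => /orP[/eqP ->//|/tU[]].
  have [b xb] := Us x Ux; exists (b / a); apply: Ut; split.
    by apply: subspaceB => //; exact: subspaceZ.
  have -> : x - (b / a) *: u = - (b / a) *: (u - a *: v) + (x - b *: v).
    rewrite scalerBr scalerA mulNr divfK // scaleNr scaleNr opprK addrACA.
    by rewrite addrN addr0 addrC.
  exact: (fspan_subspace s).2.
exists t => [w /tU[]//|x Ux]; apply: Ut; split=> //.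
have [a xa] := Us x Ux; have [a0|a0] := eqVneq a 0.
  by move: xa; rewrite a0 scale0r subr0.
by exfalso; apply: no; exists x, a.
Qed.

(** The qualitative rank-nullity theorem: spanning vectors of the image are lifted to [U] and joined
    to those of the kernel part. *)
Lemma findim_extension V W (f : {linear V -> W}) (U : set V) : subspace U ->
  findim (f @` U) -> findim (U `&` [set x | f x = 0]) -> findim U.
Proof.
move=> US fU [t Ut]; have [s sU Us] := findim_basis (subspace_image f US) fU.
have [s' s'U fs'] : exists2 s', {in s', forall v, U v} & map f s' = s.
  elim: s sU {Us} => [|w s IH] sU; first by exists [::].
  have [|s' s'U <-] := IH; first by move=> v vs; apply: sU; rewrite inE vs orbT.
  have [x Ux <-] := sU w (mem_head _ _); exists (x :: s') => // v.
  by rewrite inE => /orP[/eqP ->//|/s'U].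
exists (s' ++ t) => x Ux.
have := Us (f x) (ex_intro2 _ _ x Ux erefl).
rewrite -fs' -fspan_image => -[y ys fy].
rewrite -(subrKC y x); apply: fspan_cat => //; apply: Ut; split.
  by apply: subspaceB => //; exact: fspan_mono ys.
by rewrite /= linearB /= fy subrr.
Qed.

Lemma fspan_sum V I (r : seq I) (a : I -> K) (v : I -> V) :
  fspan (map v r) (\sum_(i <- r) a i *: v i).
Proof.
elim: r => [|i r IH] /=; first by rewrite big_nil.
by exists (a i); rewrite big_cons addrAC subrr add0r.
Qed.

Lemma fspanP V (s : seq V) x : fspan s x ->
  exists a : 'I_(size s) -> K, x = \sum_(i < size s) a i *: s`_i.
Proof.
elim: s x => [|v s IH] x /=; first by move=> ->; exists (fun=> 0); rewrite big_ord0.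
move=> [b /IH[a xa]]; exists (fun i => oapp a b (unlift ord0 i)).
rewrite big_ord_recl unlift_none /= -(subrK (b *: v) x) xa addrC.
by congr (_ + _); apply: eq_bigr => i _; rewrite liftK.
Qed.

End FiniteDimension.

Section FiniteDimensionNormed.
Variable R : realType.
Implicit Types V W : normedModType R[i].

Lemma findim_quotientP V (U W : set V) : finite_dim_quotient U W <->
  exists2 s, {in s, forall v, U v} &
    forall u, U u -> exists2 v, fspan s v & W (u - v).
Proof.
split=> [[n [v [vU UW]]]|[s sU UW]].
  exists (map v (index_enum 'I_n)) => [_ /mapP[i _ ->]//|u /UW[a uW]].
  by exists (\sum_(i < n) a i *: v i) => //; exact: fspan_sum.
exists (size s), (fun i => s`_i); split=> [i|u /UW[w /fspanP[a ->] uw]].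
  by apply: sU; exact: mem_nth.
by exists a.
Qed.

Lemma findim_quotient0P V (U : set V) : subspace U ->
  finite_dim_quotient U [set 0] <-> findim U.
Proof.
move=> US; rewrite findim_quotientP; split=> [[s _ Us]|/(findim_basis US)[s sU Us]].
  by exists s => u /Us[v vs /eqP]; rewrite subr_eq0 => /eqP ->.
by exists s => // u /Us us; exists u => //=; rewrite subrr.
Qed.

Definition rank1 V (h : dual V) (v : V) : V -> V := fun x => (h x : R[i]) *: v.

Lemma rank1_bounded V (h : dual V) (v : V) : rank1 h v \in bounded_linear V V.
Proof.
apply: (@nrm_bounded_linear _ _ _ _ (nrm h * nrm v)) => [a x y|x].
  by rewrite /rank1 linearP scalerDl scalerA.
by rewrite /rank1 nrmZ mulrAC ler_wpM2r ?nrm_ge0 // nrm_bop.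
Qed.

(** A Gram-Schmidt process in which Hahn-Banach functionals replace the inner product. *)
Lemma findim_projection V (s : seq V) : exists p : bop V V,
  (forall x, fspan s (p x)) /\ (forall x, fspan s x -> p x = x).
Proof.
elim: s => [|v s [p [ps pid]]]; first by exists 0; split=> // x ->; rewrite linear0.
have pp x : p (p x) = p x by apply: pid; exact: ps.
have [vs|/eqP y0] := eqVneq (v - p v) 0.
  have fv : fspan s v by move/eqP: vs; rewrite subr_eq0 => /eqP ->.
  exists p; split=> [x|x [a /pid]].
    by exists 0; rewrite scale0r subr0.
  rewrite linearB linearZ /= (pid v fv).
  by move=> /addIr.
have [h hy] := dual_separates (introN eqP y0); set y := v - p v in y0 hy.
(* Evaluating [h] at [x - p x] makes the new term vanish on the old span, while [h y = 1] makes [q]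
   fix [v]. *)
have [q qE] : exists q : bop V V, forall x, q x = p x + (h (x - p x) : R[i]) *: y.
  by exists (p + Bop (rank1_bounded (compop h (idop V - p)) y)).
have qid x : fspan s x -> q x = x.
  by move=> /pid px; rewrite qE px subrr linear0 scale0r addr0.
have qv : q v = v by rewrite qE -/y hy scale1r addrC subrK.
exists q; split=> [x|x [a xa]].
  rewrite qE; exists (h (x - p x) : R[i]); rewrite -addrA -scalerBr.
  rewrite /y addrAC subrr add0r scalerN.
  by apply: (subspaceB (fspan_subspace s)) => //; exact/(subspaceZ _ (fspan_subspace s)).
have {1}-> : x = x - a *: v + a *: v by rewrite subrK.
by rewrite addrC (bop_is_linear q) (qid _ xa) qv addrC subrK.
Qed.

Lemma findim_separates V (s : seq V) y : ~ fspan s y ->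
  exists h : dual V, (forall x, fspan s x -> h x = 0) /\ h y != 0.
Proof.
have [p [ps pid]] := findim_projection s => ys.
have y0 : y - p y != 0.
  by apply/negP; rewrite subr_eq0 => /eqP ye; apply: ys; rewrite ye.
have [h hy] := dual_separates y0; exists (compop h (idop V - p)); split=> [x /pid px|].
  have -> : compop h (idop V - p) x = h (x - p x) by [].
  by rewrite px subrr linear0.
have -> : compop h (idop V - p) y = h (y - p y) by [].
by rewrite hy oner_eq0.
Qed.

Lemma findim_bop_image V W (f : bop V W) (U : set V) (U' : set W) :
  findim U -> U' `<=` f @` U -> findim U'.
Proof. by move=> fU /findim_sub; apply; exact: findim_image. Qed.

Lemma findim_bop_extension V W (f : bop V W) (U : set V) : subspace U ->
  findim (f @` U) -> findim (U `&` [set x | f x = 0]) -> findim U.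
Proof. exact: findim_extension. Qed.

Lemma subspace_bop_image V W (f : bop V W) (U : set V) :
  subspace U -> subspace (f @` U).
Proof. exact: subspace_image. Qed.

Lemma closed_ker V (W : normedModType R[i]) (f : bop V W) :
  closed [set x | f x = 0].
Proof.
have fc : continuous f.
  apply: bounded_linear_continuous; apply/ex_bound.
  have [M M0 fM] := bop_bound f; exists M%:C.
  apply/nbhs_norm0P; exists 1 => //= x x1.
  apply: (le_trans (fM x)); rewrite ler_piMr ?lecR //; exact: ltW.
have -> : [set x | f x = 0] = f @^-1` [set 0] by [].
apply: preimage_closed => //.
exact/accessible_closed_set1/hausdorff_accessible/norm_hausdorff.
Qed.

End FiniteDimensionNormed.

(** * Resolvents and power series *)

Section Resolvent.
Variable R : realType.
Implicit Types (D E F W : normedModType R[i]).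

Lemma nrm_compop D E F (g : bop E F) (f : bop D E) :
  nrm (compop g f) <= nrm g * nrm f.
Proof.
apply: bop_nrm_le => [|x]; first by rewrite mulr_ge0 ?nrm_ge0.
by rewrite (le_trans (nrm_bop g (f x))) // -mulrA ler_wpM2l ?nrm_ge0 // nrm_bop.
Qed.

Lemma eval_bounded E F (U : bop E F) (e : E) :
  (fun T : bop E E => U (T e)) \in bounded_linear (bop E E) F.
Proof.
apply: (@nrm_bounded_linear _ _ _ _ (nrm U * nrm e)) => [a S T|T].
  by rewrite -linearP.
rewrite (le_trans (nrm_bop _ _)) // -mulrA ler_wpM2l ?nrm_ge0 //.
by rewrite mulrC nrm_bop.
Qed.

Lemma sandwich_bounded D E F (U : bop E F) (V : bop D E) :
  (fun T : bop E E => compop U (compop T V)) \in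
    bounded_linear (bop E E) (bop D F).
Proof.
apply: (@nrm_bounded_linear _ _ _ _ (nrm U * nrm V)) => [a S T|T].
  by apply: bopP => x; rewrite -[RHS]/(_ *: U (S (V x)) + U (T (V x))) -linearP.
rewrite (le_trans (nrm_compop _ _)) // -mulrA ler_wpM2l ?nrm_ge0 //.
by rewrite mulrC nrm_compop.
Qed.

(** On the disc [m N] has norm at most 1/2, so the Neumann inverse exists with a bound uniform in
    [m]. Outside the disc [H] takes arbitrary values. *)
Lemma resolvent_family (E : completeNormedModType R[i]) (N : bop E E) (r : R) :
  r * nrm N <= 1 / 2 ->
  exists H : R[i] -> bop E E, forall m, nrm (m : R[i]^o) < r ->
    [/\ forall x, H m x - m *: N (H m x) = x,
        forall x, H m (x - m *: N x) = x & nrm (H m) <= 2].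
Proof.
move=> rN; have ex m : exists H : bop E E, nrm (m : R[i]^o) < r ->
    [/\ forall x, H x - m *: N (H x) = x,
        forall x, H (x - m *: N x) = x & nrm H <= 2].
  have [mr|] := pselect (nrm (m : R[i]^o) < r); last by exists 0.
  have [|H HP] := @neumann_inverse _ E (m *: N); last by exists H.
  rewrite nrmZ (le_trans _ rN) // ler_wpM2r ?nrm_ge0 //; exact: ltW.
by have [H HP] := choice ex; exists H.
Qed.

(* Around z the resolvent expands as a Neumann series in N (1 - z N)^-1, with
   an explicit remainder. *)
Lemma resolvent_analytic (E : completeNormedModType R[i]) W (N : bop E E)
    (r : R) (H : R[i] -> bop E E) (L : bop (bop E E) W) (l0 : R[i]) :
  r * nrm N <= 1 / 2 ->
  (forall m, nrm (m : R[i]^o) < r ->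
    [/\ forall x, H m x - m *: N (H m x) = x,
        forall x, H m (x - m *: N x) = x & nrm (H m) <= 2]) ->
  analytic_on (disc l0 r) (fun l => L (H (l - l0))).
Proof.
move=> rN HP z; rewrite /disc /= (nrm_lt (z - l0 : R[i]^o)) => zr.
set nz := nrm (z - l0 : R[i]^o) in zr.
have [H1 H2 H3] := HP _ zr; set R1 := H (z - l0) in H1 H2 H3.
pose g (T : bop E E) : bop E E := compop (compop N R1) T.
(* The second term keeps [w] in the disc of radius [r]. The first makes the ratio of the series at
   most 1/2, since [g] multiplies norms by at most [2 * nrm N]. *)
pose rho := Num.min (r / 2) (r - nz).
exists rho, (fun n => L (iter n g R1)); split.
  by have := nrm_ge0 (z - l0 : R[i]^o); rewrite -/nz lt_min; lra.
move=> w; rewrite /disc /= (nrm_lt (w - z : R[i]^o)) lt_min => /andP[].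
set h := w - z => hr hz.
have wr : nrm (w - l0 : R[i]^o) < r.
  have -> : (w - l0 : R[i]^o) = h + (z - l0) by rewrite /h subrKA.
  by rewrite (le_lt_trans (nrmD _ _)) // -/nz; lra.
have [W1 W2 W3] := HP _ wr; set Rw := H (w - l0) in W1 W2 W3 *.
have R1N x : R1 (N x) = N (R1 x).
  rewrite -[RHS]H2; congr (R1 _).
  by rewrite -linearZ -linearB H1.
have gD S T (a : R[i]) n : iter n g (S + a *: T) = iter n g S + a *: iter n g T.
  elim: n => // n IH; rewrite !iterS IH; apply: bopP => x.
  rewrite -[LHS]/(N (R1 (iter n g S x + a *: iter n g T x))) addrC.
  by rewrite (bop_is_linear R1) (bop_is_linear N) addrC.
(* The resolvent identity between the parameters [z - l0] and [w - l0]; iterating it produces the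
   series and its remainder. *)
have Rwg : Rw = R1 + h *: g Rw.
  apply: bopP => x.
  rewrite -[RHS]/(R1 x + h *: N (R1 (Rw x))).
  have xE : x = (Rw x - (z - l0) *: N (Rw x)) - h *: N (Rw x).
    rewrite -addrA -opprD -scalerDl [z - l0 + h]addrC /h subrKA.
    exact/esym/W1.
  have -> : R1 x = Rw x - h *: R1 (N (Rw x)).
    by rewrite [in LHS]xE (linearB R1) /= H2 (linearZ_LR R1).
  by rewrite R1N subrK.
have partial n : L Rw - series (fun k => h ^+ k *: L (iter k g R1)) n =
    h ^+ n *: L (iter n g Rw).
  elim: n => [|n IH]; first by rewrite /series /= big_geq // subr0 expr0 scale1r.
  rewrite /series /= big_nat_recr //= opprD addrA IH {1}Rwg gD -iterSr.
  by rewrite linearD linearZ scalerDr addrAC subrr add0r scalerA exprSr.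
have gn n : nrm (iter n g Rw) <= 2 * (2 * nrm N) ^+ n.
  elim: n => [|n IH]; first by rewrite expr0 mulr1.
  rewrite iterS (le_trans (nrm_compop _ _)) // exprS mulrCA.
  rewrite ler_pM ?nrm_ge0 // (le_trans (nrm_compop _ _)) // mulrC.
  by rewrite ler_wpM2r ?nrm_ge0.
apply: (@cvg_half_pow _ _ _ _ (2 * nrm L)) => n.
rewrite partial nrmZ nrmX (le_trans (ler_wpM2l _ (nrm_bop _ _))) //.
  by rewrite exprn_ge0 ?nrm_ge0.
rewrite mulrCA [leRHS]mulrAC [leRHS]mulrC ler_wpM2l ?nrm_ge0 //.
rewrite (le_trans (ler_wpM2l _ (gn n))) ?exprn_ge0 ?nrm_ge0 //.
rewrite mulrCA ler_wpM2l // -exprMn -exprVn.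
rewrite lerXn2r ?nnegrE ?mulr_ge0 ?nrm_ge0 ?invr_ge0 //.
have := ler_wpM2r (nrm_ge0 N) (ltW hr); lra.
Qed.

End Resolvent.

Section PowerSeries.
Variables (R : realType) (V : normedModType R[i]).

Lemma pseries_coef_bounded (c : nat -> V) (l : V) (t : R) :
  0 < t -> series (fun n => (t%:C) ^+ n *: c n) @ \oo --> l ->
  exists2 B : R, 0 <= B & forall n, nrm (c n) <= B / t ^+ n.
Proof.
move=> t0 /cvg_nrmP/(_ 1 ltr01)[N sN].
pose s := series (fun n => (t%:C) ^+ n *: c n).
have sS n : (t%:C) ^+ n *: c n = s n.+1 - s n.
  by rewrite /s /series /= big_nat_recr //= addrAC subrr add0r.
have tc n : nrm ((t%:C) ^+ n *: c n) = t ^+ n * nrm (c n).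
  by rewrite -rmorphXn nrmZr ger0_norm // exprn_ge0 // ltW.
(* The sum covers the terms before [N]; later ones are differences of two partial sums within 1 of
   the limit, hence the 2. *)
pose B := 2 + \sum_(n < N) t ^+ n * nrm (c n).
have B0 : 0 <= B.
  rewrite addr_ge0 // sumr_ge0 // => i _.
  by rewrite mulr_ge0 ?nrm_ge0 // exprn_ge0 // ltW.
exists B => // n; rewrite ler_pdivlMr ?exprn_gt0 // mulrC -tc.
have [nN|Nn] := ltnP n N.
  rewrite /B (bigD1 (Ordinal nN)) //= tc addrCA lerDl addr_ge0 // sumr_ge0 // => i _.
  by rewrite mulr_ge0 ?nrm_ge0 // exprn_ge0 // ltW.
rewrite sS -(subrKA l) (le_trans (nrmD _ _)) //.
have := sN _ Nn; have := sN _ (leqW Nn); rewrite -/s (nrmBC l (s n.+1)).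
have : 0 <= \sum_(n < N) t ^+ n * nrm (c n).
  apply: sumr_ge0 => i _; by rewrite mulr_ge0 ?nrm_ge0 // exprn_ge0 // ltW.
rewrite /B; lra.
Qed.

(** If the coefficients before [n] vanish, then at a small zero [h] the term of degree [n] is minus
    the tail, which is of order [n + 1] in [h]. Dividing by the [n]-th power of the norm of [h] and
    letting [h] tend to 0 gives [c n = 0]. *)
Lemma pseries_isolated_zeros (c : nat -> V) (f : R[i] -> V) (r : R) : 0 < r ->
  (forall h, nrm (h : R[i]^o) < r -> series (fun n => h ^+ n *: c n) @ \oo --> f h) ->
  (forall e : R, 0 < e -> exists h, [/\ h != 0, nrm (h : R[i]^o) < e & f h = 0]) ->
  forall n, c n = 0.
Proof.
move=> r0 fP f0 n; elim/ltn_ind: n => n IH.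
pose t := r / 2; have t0 : 0 < t by rewrite /t; lra.
have tr : nrm (t%:C : R[i]^o) < r by rewrite nrm_real gtr0_norm // /t; lra.
have [B B0 cB] := pseries_coef_bounded t0 (fP _ tr).
(* For ratio [q = a / t] at most 1/2 the tail is at most [2 * B * q ^+ n.+1], that is
   [a ^+ n * (K * a)]; taking [a] below [e / (K + 1)] makes [K * a] at most [e]. *)
pose K := 2 * B / t ^+ n.+1.
have K0 : 0 <= K by rewrite divr_ge0 ?mulr_ge0 ?exprn_ge0 // ltW.
apply: nrm_le0; apply/ler_addgt0Pr => e e0; rewrite add0r.
have [h [hn0 he fh0]] : exists h : R[i],
    [/\ h != 0, nrm (h : R[i]^o) < Num.min (t / 2) (e / (K + 1)) & f h = 0].
  apply: f0; rewrite lt_min divr_gt0 //= divr_gt0 //; lra.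
move: he; rewrite lt_min; set a := nrm (h : R[i]^o) => /andP[at2 ae].
have a0 : 0 < a by exact: (@nrm_gt0 _ (R[i]^o : normedModType _)).
pose q := a / t.
have q0 : 0 < q by rewrite divr_gt0.
have q2 : q <= 1 / 2 by rewrite ler_pdivrMr //; lra.
have term k : nrm (h ^+ k *: c k) <= B * q ^+ k.
  rewrite nrmZ nrmX -/a /q expr_div_n mulrCA.
  by rewrite ler_wpM2l ?cB // exprn_ge0 // ltW.
have tail m : nrm (\sum_(n.+1 <= k < n.+1 + m) h ^+ k *: c k) <=
    2 * B * q ^+ n.+1 * (1 - 1 / 2 ^+ m).
  elim: m => [|m IHm].
    by rewrite addn0 big_geq // nrm0 expr0 divr1 subrr mulr0.
  rewrite addnS big_nat_recr ?leq_addr //= (le_trans (nrmD _ _)) //.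
  rewrite (le_trans (lerD IHm (term _))) //.
  have : q ^+ (n.+1 + m) <= q ^+ n.+1 / 2 ^+ m.
    rewrite exprD ler_pM2l ?exprn_gt0 // -exprVn lerXn2r ?nnegrE ?invr_ge0 //.
      exact: ltW.
    by rewrite -div1r.
  move=> /(ler_wpM2l B0); rewrite [2 ^+ m.+1]exprS [(2 * _)^-1]invfM; lra.
have anc : nrm (h ^+ n *: c n) <= 2 * B * q ^+ n.+1.
  apply/ler_addgt0Pr => d d0.
  have ar : a < r by move: at2; rewrite /t; lra.
  have /cvg_nrmP/(_ _ d0)[N sN] := fP h ar.
  have := sN (n.+1 + N)%N (leq_addl _ _); rewrite fh0 sub0r nrmN => sd.
  have : h ^+ n *: c n = series (fun n => h ^+ n *: c n) (n.+1 + N)%N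
      - \sum_(n.+1 <= k < n.+1 + N) h ^+ k *: c k.
    rewrite /series /= (big_cat_nat _ (n := n.+1)) ?leq_addr //= addrK.
    rewrite big_nat_recr //= big_nat_cond big1 ?add0r // => i.
    by rewrite andbT => /andP[_ iN]; rewrite IH // scaler0.
  move=> ->; rewrite (le_trans (nrmB _ _)) // addrC lerD ?(ltW sd) //.
  rewrite (le_trans (tail N)) // ler_piMr ?mulr_ge0 ?exprn_ge0 ?(ltW q0) //.
  by rewrite lerBlDr lerDl divr_ge0 ?exprn_ge0.
have : nrm (c n) <= K * a.
  move: anc; rewrite nrmZ nrmX -/a.
  have -> : 2 * B * q ^+ n.+1 = a ^+ n * (K * a).
    by rewrite /K /q expr_div_n exprS; ring.
  by rewrite ler_pM2l ?exprn_gt0.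
move=> /le_trans; apply.
move: ae; rewrite ltr_pdivlMr; last by lra.
lra.
Qed.

(** Continuation along the segment from [l0] to [l]: at the supremum [T] of the parameters up to
    which [f] vanishes, zeros accumulate, so the power series there is zero and [f] vanishes beyond
    [T] unless [T = 1]. *)
Lemma identity_theorem (f : R[i] -> V) (l0 : R[i]) (r d : R) : 0 < d ->
  analytic_on (disc l0 r) f ->
  (forall l, nrm (l - l0 : R[i]^o) < d -> f l = 0) ->
  forall l, disc l0 r l -> f l = 0.
Proof.
move=> d0 fan fd l lr.
pose z (t : R) := l0 + t%:C * (l - l0).
have zB s t : nrm (z s - z t : R[i]^o) = `|s - t| * nrm (l - l0 : R[i]^o).
  rewrite /z opprD addrACA subrr add0r -mulrBl -rmorphB /=.
  exact: (nrmZr (s - t) (l - l0 : R[i]^o)).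
have z0 : z 0 = l0 by rewrite /z mul0r addr0.
have z1 : z 1 = l by rewrite /z mul1r addrC subrK.
have [->|ln0] := eqVneq l l0; first by apply: fd; rewrite subrr nrm0.
have nl : 0 < nrm (l - l0 : R[i]^o).
  by apply: (@nrm_gt0 _ (R[i]^o : normedModType _)); rewrite subr_eq0.
set n := nrm (l - l0 : R[i]^o) in zB nl.
have nr : n < r by move: lr; rewrite /disc /= (nrm_lt (l - l0 : R[i]^o)).
pose A := [set t : R | 0 <= t <= 1 /\ forall s, 0 <= s <= t -> f (z s) = 0].
have A0 : A (Num.min 1 (d / n / 2)).
  split; first by rewrite le_min ge_min lexx /= ler01 !divr_ge0 // ltW.
  move=> s /andP[s0 sd]; apply: fd; rewrite -z0 zB subr0 ger0_norm //.
  rewrite -ltr_pdivlMr // (le_lt_trans sd) // gt_min; apply/orP; right.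
  by rewrite ltr_pdivrMr // ltr_pMr ?ltr1n // divr_gt0.
have hA : has_sup A by split; [exists (Num.min 1 (d / n / 2))|exists 1 => t [/andP[]]].
pose T := sup A.
have T1 : T <= 1 by apply: ge_sup; [exact: hA.1|move=> t [/andP[]]].
have T0 : 0 < T.
  apply: (@lt_le_trans _ _ (Num.min 1 (d / n / 2))); last exact: ub_le_sup hA.2 _ A0.
  by rewrite lt_min ltr01 /= !divr_gt0.
have fT s : 0 <= s < T -> f (z s) = 0.
  move=> /andP[s0 sT]; have [t [_ At] st] := sup_gt hA.1 sT.
  by apply: At; rewrite s0 ltW.
have zT : disc l0 r (z T).
  rewrite /disc /= (nrm_lt (z T - l0 : R[i]^o)) -z0 zB subr0 gtr0_norm //.
  by rewrite (le_lt_trans _ nr) // ler_piMl // ltW.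
have [rho [c [rho0 cP]]] := fan _ zT.
have c0 : forall k, c k = 0.
  apply: (@pseries_isolated_zeros c (fun h => f (z T + h)) rho) => // [h hr|e e0].
    have := cP (z T + h); rewrite /disc /= addrAC subrr add0r; apply.
    by rewrite (nrm_lt (h : R[i]^o)).
  pose u := Num.min (T / 2) (e / n / 2).
  have u0 : 0 < u by rewrite lt_min !divr_gt0.
  have uT : u <= T / 2 by rewrite ge_min lexx.
  exists (z (T - u) - z T); split.
  - have : 0 < nrm (z (T - u) - z T : R[i]^o).
      by rewrite zB addrAC subrr add0r normrN gtr0_norm // mulr_gt0.
    by apply: contraTneq => ->; rewrite nrm0 ltxx.
  - rewrite zB addrAC subrr add0r normrN gtr0_norm // -ltr_pdivlMr //.
    rewrite gt_min; apply/orP; right.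
    by rewrite ltr_pdivrMr // ltr_pMr ?ltr1n // divr_gt0.
  - by rewrite addrC subrK; apply: fT; lra.
have fz w : nrm (w - z T : R[i]^o) < rho -> f w = 0.
  move=> wr; have /cvg_nrmP fw : series (fun n => (w - z T) ^+ n *: c n) @ \oo --> f w.
    by apply: cP; rewrite /disc /= (nrm_lt (w - z T : R[i]^o)).
  apply: nrm_le0; apply/ler_addgt0Pr => e /fw[N /(_ N (leqnn _))].
  rewrite /series /= big1 ?subr0 ?add0r; first exact: ltW.
  by move=> k _; rewrite c0 scaler0.
have [T1'|T1'] := ltP T 1; last first.
  have TE : T = 1 by apply/eqP; rewrite eq_le T1.
  by rewrite -z1 -TE; apply: fz; rewrite subrr nrm0.
(* A parameter past [T] whose point is still in the disc of convergence around [z T]. *)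
pose u := Num.min 1 (T + rho / n / 2).
have uT : T < u by rewrite lt_min T1' ltrDl !divr_gt0.
suff : A u by move=> /(ub_le_sup hA.2); rewrite leNgt uT.
split=> [|s /andP[s0 su]]; first by rewrite (ltW (lt_trans T0 uT)) ge_min lexx.
have [sT|Ts] := ltP s T; first by apply: fT; rewrite s0.
apply: fz; rewrite zB ger0_norm ?subr_ge0 // -ltr_pdivlMr //.
have : u <= T + rho / n / 2 by rewrite ge_min lexx orbT.
have : 0 < rho / n by rewrite divr_gt0.
lra.
Qed.

End PowerSeries.

(** * Fitting decompositions and the Drazin inverse *)

(** This makes the direct sum a Banach space, so that the Drazin inverse, which rests on the open
    mapping theorem, is available for triangular operators. *)
Lemma prod_complete (K : numFieldType) (U V : completeNormedModType K)
    (F : set_system (U * V : normedModType K)%type) :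
  ProperFilter F -> cauchy F -> cvg F.
Proof.
move=> FF /cauchyP Fc.
have fstF : cvg ((fst : U * V -> U) @ F).
  apply: cauchy_cvg; apply/cauchy_exP => e /Fc[p Fp]; exists p.1.
  by apply: (@filterS _ F _ _ _ _ Fp) => -[x y] [].
have sndF : cvg ((snd : U * V -> V) @ F).
  apply: cauchy_cvg; apply/cauchy_exP => e /Fc[p Fp]; exists p.2.
  by apply: (@filterS _ F _ _ _ _ Fp) => -[x y] [].
have /cvg_ex[u Fu] := fstF; have /cvg_ex[v Fv] := sndF.
apply/cvg_ex; exists (u, v).
have := cvg_pair Fu Fv; move=> /(_ _ _ _) FA A /FA.
by rewrite /= /nbhs /= => hA; apply: (@filterS _ F _ _ _ _ hA) => -[].
Qed.

HB.instance Definition _ (K : numFieldType) (U V : completeNormedModType K) :=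
  Uniform_isComplete.Build (U * V)%type (@prod_complete K U V).

Section Fitting.
Variable R : realType.
Implicit Types V W : normedModType R[i].

Definition powop V (S : bop V V) n : bop V V := iter n (compop S) (idop V).

Lemma powopE V (S : bop V V) n x : powop S n x = iter n S x.
Proof. by elim: n => //= n ->. Qed.

Lemma iter_linear V (S : bop V V) n : linear (iter n S).
Proof. by move=> a u v; rewrite -!powopE linearP. Qed.

Lemma iter0 V (S : bop V V) n : iter n S 0 = 0.
Proof. by rewrite -powopE linear0. Qed.

Lemma iterB V (S : bop V V) n x y : iter n S (x - y) = iter n S x - iter n S y.
Proof. by rewrite -!powopE linearB. Qed.

Lemma iter_add V (S : bop V V) n x y : iter n S (x + y) = iter n S x + iter n S y.
Proof. by rewrite -!powopE linearD. Qed.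

Lemma iterDn V (S : bop V V) m n x : iter (m + n) S x = iter m S (iter n S x).
Proof. exact: iterD. Qed.

Lemma iter_comm V (S T : bop V V) n x : (forall y, S (T y) = T (S y)) ->
  iter n S (T x) = T (iter n S x).
Proof. by move=> ST; elim: n => //= n ->. Qed.

(* At [n = 0] this says that S is bijective, so [n] bounds both the ascent and
   the descent. *)
Definition fitting V (S : bop V V) n :=
  [/\ forall x, iter n.+1 S x = 0 -> iter n S x = 0,
      forall x, exists y, iter n S x = iter n.+1 S y &
      findim [set x | iter n S x = 0]].

Lemma fitting_ker V (S : bop V V) n m x :
  (forall x, iter n.+1 S x = 0 -> iter n S x = 0) ->
  iter m S x = 0 -> iter n S x = 0.
Proof.
move=> kS; have [mn mx|/ltnW nm] := leqP m n.
  by rewrite -(subnK mn) iterDn mx iter0.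
rewrite -(subnKC nm); elim: (m - n)%N x => [|k IH] x; first by rewrite addn0.
by rewrite addnS iterSr => /IH h; apply: kS; rewrite iterSr.
Qed.

Lemma fitting_ran V (S : bop V V) n m x :
  (forall x, exists y, iter n S x = iter n.+1 S y) ->
  exists y, iter n S x = iter (n + m) S y.
Proof.
move=> rS; elim: m => [|m [y IH]]; first by exists x; rewrite addn0.
have [z nz] := rS y; exists z.
by rewrite IH addnC iterDn nz -iterDn !addnS addnC.
Qed.

Lemma fitting_mono V (S : bop V V) n m : (n <= m)%N -> fitting S n -> fitting S m.
Proof.
move=> nm [kS rS fS]; split.
- by move=> x /(fitting_ker kS) nx; rewrite -(subnK nm) iterDn nx iter0.
- move=> x; have [y xy] := rS x; exists y.
  by rewrite -[in LHS](subnK nm) iterDn xy -iterDn addnS subnK.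
- by apply: findim_sub fS => x /= /(fitting_ker kS).
Qed.

Lemma iter_ker_subspace V (S : bop V V) n : subspace [set x | iter n S x = 0].
Proof.
split=> [|a u v /= un vn]; first by rewrite /= iter0.
by rewrite iter_linear un vn scaler0 addr0.
Qed.

Lemma findim_iter_ker V (S : bop V V) n :
  findim [set x | S x = 0] -> findim [set x | iter n S x = 0].
Proof.
move=> fS; elim: n => [|n IH]; first by exists [::].
apply: (@findim_extension _ _ _ S); first exact: iter_ker_subspace.
  by apply: findim_sub IH => _ [x /= nx <-]; rewrite -iterSr.
by apply: findim_sub fS => x [].
Qed.

Lemma browder_fitting V (T : bop V V) l : browder_at T l ->
  exists n, fitting (T - l *: idop V) n.
Proof.
move=> [[_ fk _] [n [[kn _] [rn _]]]]; exists n; set S := T - _ in fk kn rn *.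
split.
- by move=> x nx; have : [set x | iter n.+1 S x = 0] x by []; rewrite -kn.
- move=> x; have : range (iter n S) (iter n S x) by exists x.
  by rewrite rn => -[y _ <-]; exists y.
- apply: findim_iter_ker; apply/findim_quotient0P => //; exact: subspace_ker.
Qed.

(* G = S^n + p, with p a projection onto ker S^n, is bijective; the spectral
   projection is p G^-1 and the Drazin inverse S^(n-1) (1 - p G^-1) G^-1. *)
Lemma drazin_inverse (V : completeNormedModType R[i]) (S : bop V V) n :
  fitting S n.+1 -> exists N P : bop V V,
  [/\ forall x, S (N x) = x - P x, forall x, N (S x) = x - P x,
      forall x, N (P x) = 0 /\ P (N x) = 0, forall x, iter n.+1 S (P x) = 0 &
      forall x, iter n.+1 S x = 0 -> P x = x].
Proof.
move=> fS; have [kS rS fk] := fS; set m := n.+1 in kS rS fk *.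
have kk x : iter m S (iter m S x) = 0 -> iter m S x = 0.
  by rewrite -iterDn; exact: fitting_ker.
have [s sK Ks] := findim_basis (iter_ker_subspace S m) fk.
have {sK} sK : fspan s `<=` [set x | iter m S x = 0].
  exact: fspan_mono (iter_ker_subspace S m) sK.
have [p [ps pid]] := findim_projection s.
have [G GE] : exists G : bop V V, forall x, G x = iter m S x + p x.
  by exists (powop S m + p) => x; rewrite -powopE.
have Sp x : iter m S (p x) = 0 by apply: sK; exact: ps.
have Ginj x : G x = 0 -> x = 0.
  rewrite GE => Gx.
  have Sx : iter m S x = 0.
    apply: kk; have := congr1 (iter m S) Gx.
    by rewrite -[in LHS](scale1r (iter m S x)) iter_linear Sp addr0 scale1r iter0.
  by move: Gx; rewrite Sx add0r pid //; exact: Ks.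
have Gsurj z : exists x, G x = z.
  have [x zx] : exists x, iter m S z = iter (m + m) S x by exact: fitting_ran.
  have zk : iter m S (z - iter m S x) = 0 by rewrite iterB zx iterDn subrr.
  (* [G] sends [x - p x] to [S^m x], because [p] kills it and [S^m] kills [p x]; and it fixes
     [z - S^m x], which lies in the kernel of [S^m]. *)
  exists (x - p x + (z - iter m S x)); rewrite GE.
  rewrite -[x - p x]scale1r iter_linear iterB Sp subr0 zk addr0 scale1r.
  rewrite linearP /= linearB /= (pid _ (ps x)) subrr scaler0 add0r.
  by rewrite (pid _ (Ks _ zk)) addrC subrK.
have [H GK _] := bounded_inverse Gsurj Ginj.
have [P PE] : exists P : bop V V, forall x, P x = p (H x) by exists (compop p H).
have zE z : z = iter m S (H z) + P z by rewrite -[LHS]GK GE PE.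
have SP z : iter m S (P z) = 0 by rewrite PE.
have Pid z : iter m S z = 0 -> P z = z.
  move=> Sz; rewrite [RHS]zE kk ?add0r //.
  by have := congr1 (iter m S) (zE z); rewrite iter_add SP Sz addr0 => <-.
have Pran z : P (iter m S z) = 0.
  have e : P (iter m S z) = iter m S (z - H (iter m S z)).
    by rewrite iterB {2}[iter m S z]zE addrAC subrr add0r.
  rewrite e; apply: kk; rewrite -e; exact: SP.
have PP z : P (P z) = P z by exact: Pid.
have SPC z : P (S z) = S (P z).
  rewrite {1}[z]zE linearD /= -iterS iterSr [LHS]linearD /= Pran add0r.
  by apply: Pid; rewrite -iterSr iterS SP linear0.
have [Nm NE] : exists Nm : bop V V, forall x, Nm x = H x - P (H x).
  by exists (compop (idop V - P) H).
have PN x : P (Nm x) = 0 by rewrite NE linearB /= PP subrr.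
have SN x : iter m S (Nm x) = x - P x.
  by rewrite NE iterB SP subr0; apply/eqP; rewrite eq_sym subr_eq -zE.
(* [S^m] and [P] are jointly injective because [P] fixes the kernel of [S^m]; equations for [Nm] are
   checked through this pair. *)
have uniq x y : iter m S x = iter m S y -> P x = P y -> x = y.
  move=> xy Pxy; apply/eqP; rewrite -subr_eq0 -(Pid (x - y)).
    by rewrite linearB /= Pxy subrr.
  by rewrite iterB xy subrr.
have NS x : Nm (S x) = S (Nm x).
  apply: uniq; last by rewrite PN SPC PN linear0.
  by rewrite SN -iterSr iterS SN linearB /= SPC.
have NP x : Nm (P x) = 0.
  by apply: uniq; rewrite ?PN ?linear0 // SN PP subrr iter0.
exists (compop (powop S n) Nm), P.
have NNE x : compop (powop S n) Nm x = iter n S (Nm x) by rewrite -powopE.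
split=> [x|x|x||//].
- by rewrite NNE -iterS SN.
- by rewrite NNE NS -iterSr SN.
- rewrite !NNE NP iter0; split=> //.
  have -> : P (iter n S (Nm x)) = iter n S (P (Nm x)).
    by rewrite (@iter_comm _ S P) // => y; rewrite SPC.
  by rewrite PN iter0.
- exact: SP.
Qed.

Lemma fitting_fredholm (V : completeNormedModType R[i]) (S : bop V V) n :
  fitting S n.+1 ->
  [/\ closed (range S), finite_dim_quotient [set x | S x = 0] [set 0] &
      finite_dim_quotient setT (range S)].
Proof.
move=> fS; have [kS rS fk] := fS.
have [N [P [SN NS _ SP Pid]]] := drazin_inverse fS.
have SPC x : P (S x) = S (P x).
  by apply/oppr_inj/(addrI (S x)); rewrite -SN NS linearB.
split.
- have [s sK Ks] := findim_basis (iter_ker_subspace S n.+1) fk.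
  have [p [ps pid]] := findim_projection (map S s).
  (* Since [x = S (N x) + P x], the vector [x] is in the range iff [P x] lies in the
     finite-dimensional image under [S] of the kernel of [S^(n+1)]. This exhibits the range as a
     kernel, hence closed. *)
  have -> : range S = [set x | compop (idop V - p) P x = 0].
    apply/seteqP; split=> [_ [x _ <-]|x] /=.
      rewrite -[LHS]/(P (S x) - p (P (S x))) pid ?subrr // SPC -fspan_image.
      by exists (P x) => //; apply: Ks; exact: SP.
    rewrite -[X in X = _ -> _]/(P x - p (P x)) => /eqP; rewrite subr_eq0 => /eqP Px.
    have : fspan (map S s) (P x) by rewrite Px; exact: ps.
    rewrite -fspan_image => -[k _ Sk]; exists (N x + k) => //.
    by rewrite linearD /= SN Sk subrK.
  exact: closed_ker.
- apply/findim_quotient0P; first exact: subspace_ker.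
  by apply: findim_sub fk => x Sx; rewrite /mkset iterSr Sx iter0.
- apply/findim_quotientP.
  have [s sK Ks] := findim_basis (iter_ker_subspace S n.+1) fk.
  exists s => // x _; exists (P x); first by apply: Ks; exact: SP.
  by exists (N x) => //; rewrite SN.
Qed.

Lemma fitting_ascent_descent V (S : bop V V) n : fitting S n ->
  exists k, is_ascent S k /\ is_descent S k.
Proof.
move=> [kS rS fk].
pose ks k := [set x | iter k S x = 0] = [set x | iter k.+1 S x = 0].
pose rs k := range (iter k S) = range (iter k.+1 S).
have ksP k : ks k <-> forall x, iter k.+1 S x = 0 -> iter k S x = 0.
  split=> [kk x kx|kk].
    by have : [set x | iter k.+1 S x = 0] x by []; rewrite -kk.
  apply/seteqP; split=> x; last exact: kk.
  by rewrite /= => ->; rewrite linear0.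
have rsP k : rs k <-> forall x, exists y, iter k S x = iter k.+1 S y.
  split=> [kk x|kk].
    have : range (iter k S) (iter k S x) by exists x.
    by rewrite kk => -[y _ <-]; exists y.
  apply/seteqP; split=> [_ [x _ <-]|_ [x _ <-]].
    by have [y ->] := kk x; exists y.
  by exists (S x) => //; rewrite -iterSr.
(* Kernels and ranges stabilise at the same indices, so ascent equals descent. If kernels are stable
   at [k], then [S^n x = S^(n+k+1) y] puts [x - S^(k+1) y] in the kernel of [S^k]; the converse
   writes [S^k x] as [S^(k+n) y]. *)
have ksrs k : ks k <-> rs k.
  split=> [/ksP kk|/rsP kk].
    apply/rsP => x; have [y xy] := fitting_ran k.+1 x rS.
    exists (iter k S y); apply/eqP; rewrite -subr_eq0 -iterDn addSnnS addnC.
    have : iter n S (x - iter k.+1 S y) = 0 by rewrite iterB xy iterDn subrr.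
    by move=> /(fitting_ker kk); rewrite iterB -iterDn addnC => ->.
  apply/ksP => x kx; have [y xy] := fitting_ran n x kk.
  have : iter n.+1 S (iter k S y) = 0.
    by rewrite -iterDn addSn iterS addnC -xy -iterS.
  rewrite -iterDn => /(fitting_ker kS) => ny.
  by rewrite xy iterDn ny iter0.
have [k /asboolP kk kmin] := @ex_minnP (fun k => `[< ks k >])
  (ex_intro _ n (asboolT (proj2 (ksP n) kS))).
exists k; split; split; rewrite -?/(ks _) -?/(rs _).
- exact: kk.
- by move=> j kj; apply: kmin; apply/asboolP.
- exact/ksrs.
- by move=> j /ksrs kj; apply: kmin; apply/asboolP.
Qed.

Lemma fitting_browder (V : completeNormedModType R[i]) (T : bop V V) l n :
  fitting (T - l *: idop V) n -> browder_at T l.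
Proof.
move=> fS; split; last exact: fitting_ascent_descent fS.
by apply: (@fitting_fredholm _ _ n); exact: fitting_mono (leqnSn n) fS.
Qed.

End Fitting.

(** * Single-valued extension property *)

Section SVEP.
Variable R : realType.

(** The [d k] are the coefficients of [S (f h) - h *: f h], which is identically zero, so they
    vanish. *)
Lemma analytic_coef_eigen (V : normedModType R[i]) (S : bop V V) (c : nat -> V)
    (f : R[i] -> V) (r : R) : 0 < r ->
  (forall h, nrm (h : R[i]^o) < r -> series (fun n => h ^+ n *: c n) @ \oo --> f h) ->
  (forall h, nrm (h : R[i]^o) < r -> S (f h) = h *: f h) ->
  S (c 0%N) = 0 /\ forall k, S (c k.+1) = c k.
Proof.
move=> r0 fP Sf.
pose d k := if k is j.+1 then S (c k) - c j else S (c 0%N).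
suff d0 k : d k = 0.
  split=> [|k]; first exact: (d0 0%N).
  by apply/eqP; rewrite -subr_eq0; apply/eqP; exact: (d0 k.+1).
apply: (@pseries_isolated_zeros _ _ d (fun=> 0) r) => // [h hr|e e0]; last first.
  exists (e / 2)%:C; split=> //.
    by rewrite -(rmorph0 (real_complex R)) (inj_eq (@complexI R)) gt_eqF // divr_gt0.
  by rewrite nrm_real gtr0_norm ?divr_gt0 // ltr_pdivrMr // ltr_pMr // ltr1n.
pose s := series (fun n => h ^+ n *: c n).
have seriesS (b : nat -> V) m : series b m.+1 = series b m + b m.
  by rewrite /series /= big_nat_recr.
have dE m : series (fun n => h ^+ n *: d n) m.+1 = S (s m.+1) - h *: s m.
  elim: m => [|m IH].
    rewrite seriesS [s 1%N]seriesS /s /series /= !big_geq // !add0r.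
    by rewrite !expr0 !scale1r scaler0 subr0.
  have -> : h *: s m.+1 = h *: s m + h ^+ m.+1 *: c m.
    by rewrite [s m.+1]seriesS -/s scalerDr scalerA -exprS.
  rewrite seriesS IH [s m.+2]seriesS -/s -[d m.+1]/(S (c m.+1) - c m).
  by rewrite (linearD S) (linearZ_LR S) /= opprD scalerBr addrACA.
apply/cvg_nrmP => e e0.
pose a := nrm (h : R[i]^o); have a0 : 0 <= a by exact: nrm_ge0.
pose K := nrm S + a + 1.
have K0 : 0 < K by have := nrm_ge0 S; rewrite /K; lra.
have /cvg_nrmP/(_ (e / K) (divr_gt0 e0 K0))[N sN] := fP h hr.
exists N.+1 => -[//|m] Nm; rewrite dE sub0r nrmN.
have -> : S (s m.+1) - h *: s m = h *: (f h - s m) - S (f h - s m.+1).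
  by rewrite scalerBr (linearB S) /= (Sf _ hr) opprB [RHS]addrC subrKA.
rewrite (le_lt_trans (nrmB _ _)) // nrmZ -/a.
have h1 := sN m Nm; have h2 := sN m.+1 (leqW Nm).
have {}h1 := ler_wpM2l a0 (ltW h1).
have {}h2 := ler_wpM2l (nrm_ge0 S) (ltW h2).
have h3 := nrm_bop S (f h - s m.+1).
have : (a + nrm S) * (e / K) < e.
  by rewrite mulrA ltr_pdivrMr // mulrC ltr_pM2l // /K; lra.
rewrite -/s in h1 h2; lra.
Qed.

(** The Taylor coefficients of a null solution form a backward orbit of [S] starting in its kernel:
    [c k = S^n (c (n + k))], while a power of [S] kills [c (n + k)]. Finite ascent then gives
    [c k = 0], and the identity theorem covers the whole disc. *)
Lemma SVEP_of_ascent (V : normedModType R[i]) (T : bop V V) l n :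
  (forall x, iter n.+1 (T - l *: idop V) x = 0 -> iter n (T - l *: idop V) x = 0) ->
  has_SVEP_at T l.
Proof.
move=> kS r r0 f fan fT.
have [|rho [c [rho0 cP]]] := fan l; first by rewrite /disc /= subrr normr0 ltcR.
have cP' h : nrm (h : R[i]^o) < rho ->
    series (fun n => h ^+ n *: c n) @ \oo --> f (l + h).
  move=> hr; have := cP (l + h); rewrite /disc /= addrAC subrr add0r; apply.
  by rewrite (nrm_lt (h : R[i]^o)).
pose S := T - l *: idop V; rewrite -/S in kS.
have SE x : S x = T x - l *: x by [].
have TE m x : (T - m *: idop V) x = T x - m *: x by [].
pose d := Num.min rho r.
have [c0 cS] : S (c 0%N) = 0 /\ forall k, S (c k.+1) = c k.
  apply: (@analytic_coef_eigen V S c (fun h => f (l + h)) d) => [|h|h].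
  - by rewrite lt_min rho0.
  - by rewrite lt_min => /andP[/cP'].
  - rewrite lt_min => /andP[_ hr].
    have := fT (l + h); rewrite TE SE /disc /= addrAC subrr add0r.
    rewrite (nrm_lt (h : R[i]^o)) => /(_ hr)/eqP.
    rewrite scalerDl opprD addrA subr_eq0 => /eqP; exact.
have Sck k j : iter j S (c (j + k)%N) = c k.
  by elim: j => // j IH; rewrite iterSr addSn cS IH.
have c_eq0 k : c k = 0.
  rewrite -(Sck k n); apply: (fitting_ker kS (m := (n + k).+1)).
  have := Sck 0%N (n + k)%N; rewrite addn0 => nk.
  by rewrite iterS nk c0.
apply: (identity_theorem rho0 fan) => w wr.
have /cvg_nrmP fw := cP' (w - l) wr.
rewrite addrC subrK in fw.
apply: nrm_le0; apply/ler_addgt0Pr => e /fw[N /(_ N (leqnn _))].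
rewrite /series /= big1 ?subr0 ?add0r; first exact: ltW.
by move=> k _; rewrite c_eq0 scaler0.
Qed.

Variables (E : completeNormedModType R[i]) (M N P : bop E E).
Hypothesis MN : forall x, M (N x) = x - P x.
Hypothesis NM : forall x, N (M x) = x - P x.
Hypothesis NP : forall x, N (P x) = 0.

(** The summand 1 guards against [N = 0]. *)
Let r := (2 * (nrm N + 1))^-1.

Let r_gt0 : 0 < r.
Proof. by rewrite invr_gt0 mulr_gt0 // ltr_wpDl ?nrm_ge0. Qed.

Let rN : r * nrm N <= 1 / 2.
Proof.
have n0 := nrm_ge0 N.
rewrite /r mulrC ler_pdivrMr ?mulr_gt0 ?ltr_wpDl //; lra.
Qed.

(* The witness is the analytic map m |-> L N (1 - m N)^-1 e. *)
Lemma SVEP_step (W : normedModType R[i]) (T : bop W W) l (L : bop E W) e :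
  has_SVEP_at T l ->
  (forall x, (T - l *: idop W) (L x) = L (M x)) -> (forall x, L (P x) = 0) ->
  L e = 0 -> L (N e) = 0.
Proof.
move=> Tsvep TL LP Le.
have [H HP] := resolvent_family rN.
pose Lop : bop (bop E E) W := Bop (eval_bounded (compop L N) e).
have Hl w : disc l r w -> nrm (w - l : R[i]^o) < r.
  by rewrite /disc /= (nrm_lt (w - l : R[i]^o)).
have LopE m : Lop (H m) = L (N (H m e)) by [].
have n00 : nrm (0 : R[i]^o) < r by rewrite nrm0.
have H0 : H 0 e = e.
  by have [h _ _] := HP 0 n00; have := h e; rewrite scale0r subr0.
(* At the centre the resolvent is the identity, so the null solution takes there the value
   [L (N e)]. *)
suff : Lop (H (l - l)) = 0 by rewrite subrr LopE H0.
apply: (Tsvep r r_gt0 (fun w => Lop (H (w - l))) (resolvent_analytic Lop rN HP)).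
  2: by rewrite /disc /= subrr normr0 ltcR.
move=> w /Hl wr; have [H1 _ _] := HP _ wr; set m := w - l in H1 *.
rewrite LopE.
have -> x : (T - w *: idop W) x = (T - l *: idop W) x - m *: x.
  rewrite -[LHS]/(T x - w *: x) -[(T - l *: idop W) x]/(T x - l *: x).
  by rewrite -addrA -opprD -scalerDl /m [l + _]addrC subrK.
rewrite TL MN -linearZ -linearB /=.
rewrite (_ : H m e - P (H m e) - _ = e - P (H m e)); last first.
  by rewrite addrAC H1.
by rewrite linearB /= Le LP subrr.
Qed.

(* Dually, the witness is m |-> z (1 - m N)^-1 N J. *)
Lemma SVEP_adjoint_step (W : normedModType R[i]) (A : bop W W) l
    (J : bop W E) (z : dual E) :
  has_SVEP_at (adjoint A) l ->
  (forall x, J ((A - l *: idop W) x) = M (J x)) -> (forall x, z (P x) = 0) ->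
  (forall x, z (J x) = 0) -> forall x, z (N (J x)) = 0.
Proof.
move=> Asvep JA zP zJ.
have [H HP] := resolvent_family rN.
pose Lop : bop (bop E E) (dual W) := Bop (sandwich_bounded z (compop N J)).
have Hl w : disc l r w -> nrm (w - l : R[i]^o) < r.
  by rewrite /disc /= (nrm_lt (w - l : R[i]^o)).
have LopE m x : Lop (H m) x = z (H m (N (J x))) by [].
have n00 : nrm (0 : R[i]^o) < r by rewrite nrm0.
have H0 y : H 0 y = y.
  by have [h _ _] := HP 0 n00; have := h y; rewrite scale0r subr0.
move=> x; suff : Lop (H (l - l)) = 0.
  by rewrite subrr => L0; have := LopE 0 x; rewrite L0 H0.
apply: (Asvep r r_gt0 (fun w => Lop (H (w - l))) (resolvent_analytic Lop rN HP)).
  2: by rewrite /disc /= subrr normr0 ltcR.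
move=> w /Hl wr; have [H1 H2 _] := HP _ wr; set m := w - l in H1 H2 *.
apply: bopP => {}x.
rewrite -[LHS]/(Lop (H m) (A x) - w *: Lop (H m) x) !LopE.
have AE : A x = (A - l *: idop W) x + l *: x.
  by rewrite -[(A - l *: idop W) x]/(A x - l *: x) subrK.
have -> : N (J (A x)) = J x - P (J x) + l *: N (J x).
  by rewrite AE addrC (bop_is_linear J) JA (bop_is_linear N) NM addrC.
have -> : w *: z (H m (N (J x))) = z (H m (w *: N (J x))).
  by rewrite (linearZ_LR (H m)) (linearZ_LR z).
rewrite -(linearB z) -(linearB (H m)) /=.
have -> : J x - P (J x) + l *: N (J x) - w *: N (J x) =
    (J x - m *: N (J x)) - P (J x).
  rewrite -addrA -scalerBl addrAC; congr (_ + _ - _).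
  by rewrite -scaleNr /m opprB.
(* [N] kills the range of [P], so the resolvent fixes it and [z] annihilates the remaining term. *)
have HPE y : H m (P y) = P y.
  by have := H2 (P y); rewrite NP scaler0 subr0.
by rewrite (linearB (H m)) /= H2 HPE (linearB z) /= zJ zP subrr.
Qed.

End SVEP.

(** * Triangular operators *)

Section Triangular.
Variable R : realType.

Lemma inl_bounded (X Y : normedModType R[i]) :
  (fun x : X => (x, 0) : X * Y) \in bounded_linear X (X * Y)%type.
Proof.
apply: (@nrm_bounded_linear _ _ _ _ 1) => [a u v|x].
  by congr pair; rewrite /= scaler0 addr0.
by rewrite mul1r nrm_prodE /= lexx nrm0 nrm_ge0.
Qed.

Definition inlop (X Y : normedModType R[i]) : bop X (X * Y)%type :=
  Bop (inl_bounded X Y).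

Lemma snd_bounded (X Y : normedModType R[i]) :
  (fun p : X * Y => p.2) \in bounded_linear (X * Y)%type Y.
Proof.
apply: (@nrm_bounded_linear _ _ _ _ 1) => [//|p].
by have := lexx (nrm p); rewrite mul1r nrm_prodE => /andP[].
Qed.

Definition sndop (X Y : normedModType R[i]) : bop (X * Y)%type Y :=
  Bop (snd_bounded X Y).

Lemma fst_bounded (X Y : normedModType R[i]) :
  (fun p : X * Y => p.1) \in bounded_linear (X * Y)%type X.
Proof.
apply: (@nrm_bounded_linear _ _ _ _ 1) => [//|p].
by have := lexx (nrm p); rewrite mul1r nrm_prodE => /andP[].
Qed.

Definition fstop (X Y : normedModType R[i]) : bop (X * Y)%type X :=
  Bop (fst_bounded X Y).

Lemma optri_shift (X : normedModType R[i]) (A B C : bop X X) l :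
  optri A C B - l *: idop (X * X)%type =
    optri (A - l *: idop X) C (B - l *: idop X).
Proof.
apply: bopP => -[x y].
by rewrite -[LHS]/(A x + C y - l *: x, B y - l *: y) addrAC.
Qed.

Lemma opdiag_optri (X : normedModType R[i]) (A B : bop X X) :
  opdiag A B = optri A 0 B.
Proof. by apply: bopP => -[x y]; congr pair; rewrite /= addr0. Qed.

Section Algebra.
Variables (X : normedModType R[i]) (A B C : bop X X).
Let M := optri A C B.

Lemma iter_optri_inl n x : iter n M (x, 0) = (iter n A x, 0).
Proof.
elim: n => //= n ->; rewrite -[LHS]/(A (iter n A x) + C 0, B 0).
by rewrite !linear0 addr0.
Qed.

Lemma iter_optri_snd n p : (iter n M p).2 = iter n B p.2.
Proof. by elim: n => //= n <-. Qed.

Lemma iter_optri_in_inl n y : iter n B y = 0 ->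
  exists z, iter n M (0, y) = (z, 0).
Proof.
move=> ny; exists (iter n M (0, y)).1.
have := iter_optri_snd n (0, y); rewrite /= ny.
by case: (iter n M (0, y)) => a b /= ->.
Qed.

(** The index doubles: [n] applications of [M] settle the second component and leave a vector of the
    first summand, on which [n] more act as powers of [A]. *)
Lemma fitting_optri n : fitting A n -> fitting B n -> exists m, fitting M m.
Proof.
move=> [kA rA fA] [kB rB fB]; exists (n + n)%N.
have subl p : p.2 = 0 -> p = (p.1, 0) by case: p => a b /= ->.
split.
- move=> p mp.
  have Bp : iter n B p.2 = 0.
    apply: (fitting_ker kB (m := (n + n).+1)).
    by rewrite -iter_optri_snd mp.
  have nE : iter n M p = ((iter n M p).1, 0) by apply: subl; rewrite iter_optri_snd.
  rewrite iterDn nE iter_optri_inl.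
  rewrite (fitting_ker kA (m := n.+1)) //.
  by move: mp; rewrite -addSn iterDn nE iter_optri_inl => -[].
- move=> p; have [w pw] := rB p.2.
  have uE : iter n M p - iter n.+1 M (0, w) =
      ((iter n M p - iter n.+1 M (0, w)).1, 0).
    apply: subl; rewrite -[LHS]/((iter n M p).2 - (iter n.+1 M (0, w)).2).
    by rewrite !iter_optri_snd pw subrr.
  set u := (_).1 in uE.
  have [v uv] := fitting_ran n.+1 u rA.
  exists ((v, 0) + (0, w)).
  rewrite [in LHS]iterDn -[in LHS](subrK (iter n.+1 M (0, w)) (iter n M p)) uE.
  by rewrite !(iter_add M) !iter_optri_inl uv addnS -iterDn addnS.
- apply: (findim_bop_extension (f := sndop X X)); first exact: (iter_ker_subspace M).
    apply: findim_sub fB => _ [p /= mp <-] /=.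
    by apply: (fitting_ker kB (m := (n + n)%N)); rewrite -iter_optri_snd mp.
  apply: (findim_bop_image (f := inlop X X) fA) => -[x y] [/= mp] /= y0.
  exists x; last by rewrite /= y0.
  apply: (fitting_ker kA (m := (n + n)%N)).
  by move: mp; rewrite y0 iter_optri_inl => -[].
Qed.

(* Once the descent of A is finite, a vector (z, 0) in the range of M^(n+1) can
   be corrected by (w, 0) so that the kernel of M controls the kernel of B. *)
Lemma optri_fitting n : fitting M n ->
  (forall x, exists y, iter n A x = iter n.+1 A y) ->
  fitting A n /\ fitting B n.
Proof.
move=> [kM rM fM] rA.
have kA x : iter n.+1 A x = 0 -> iter n A x = 0.
  move=> Ax; have := kM (x, 0); rewrite !iter_optri_inl Ax.
  by move=> /(_ erefl)[].
have lift m y : iter m B y = 0 -> exists w, iter n M (w, y) = 0.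
  move=> /iter_optri_in_inl[z yz].
  have [w zw] := fitting_ran m z rA; exists (- w).
  apply: (fitting_ker kM (m := (n + m)%N)).
  have -> : (- w, y) = (0, y) - (w, 0) by congr pair; rewrite /= ?sub0r ?subr0.
  rewrite (iterB M) iter_optri_inl iterDn yz iter_optri_inl zw.
  by rewrite subrr.
split; split=> //.
- apply: (findim_bop_image (f := fstop X X) fM) => x /= Ax.
  by exists (x, 0) => //=; rewrite iter_optri_inl Ax.
- by move=> y /lift[w wy]; have := iter_optri_snd n (w, y); rewrite wy.
- move=> y; have [p yp] := rM (0, y); exists p.2.
  by rewrite -iter_optri_snd -yp iter_optri_snd.
- apply: (findim_bop_image (f := sndop X X) fM) => y /= /lift[w wy].
  by exists (w, y).
Qed.

End Algebra.

Section Drazin.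
Variables (X : completeNormedModType R[i]) (A B C : bop X X) (n : nat).
Let M := optri A C B.
Variables (N P : bop (X * X)%type (X * X)%type).
Hypothesis MN : forall x, M (N x) = x - P x.
Hypothesis PN : forall x, P (N x) = 0.
Hypothesis MP : forall x, iter n.+1 M (P x) = 0.

Lemma iter_drazin k v : iter k.+1 M (iter k.+1 N v) = v - P v.
Proof.
elim: k => [|k IH]; first exact: MN.
by rewrite iterSr [iter k.+2 N v]iterS MN /= PN subr0.
Qed.

(** Subtracting [k] from [N^(n+1) (x, 0)] leaves some [(u, 0)] with the same image under [M^(n+1)].
    Hence [P (x, 0)] is [(x - A^(n+1) u, 0)], and applying [M^(n+1)] gives
    [A^(n+1) x = A^(2n+2) u]. *)
Lemma optri_descent :
  (forall x, exists2 k, iter n.+1 M k = 0 & (iter n.+1 N (x, 0)).2 = k.2) ->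
  forall x, exists y, iter n.+1 A x = iter n.+2 A y.
Proof.
move=> Nk x; have [k kM Nxk] := Nk x.
set v := iter n.+1 N (x, 0) in Nxk.
have vE : v = ((v - k).1, 0) + k.
  apply/eqP; rewrite -subr_eq; apply/eqP.
  rewrite [LHS]surjective_pairing; congr pair.
  by rewrite /= Nxk subrr.
have := iter_drazin n (x, 0); rewrite -/v vE (iter_add M) kM addr0 iter_optri_inl.
set u := (v - k).1 => PE.
have /(congr1 (iter n.+1 M)) : P (x, 0) = (x - iter n.+1 A u, 0).
  have -> : P (x, 0) = (x, 0) - (iter n.+1 A u, 0) by rewrite PE subKr.
  by congr pair; rewrite /= subr0.
rewrite MP iter_optri_inl (iterB A) => -[Ax].
exists (iter n A u); rewrite -iterDn addSnnS iterDn.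
by apply/eqP; rewrite -subr_eq0; apply/eqP/esym.
Qed.

End Drazin.
End Triangular.

(** * Comparison of the Browder points of the diagonal and triangular operators *)

Section Main.
Variables (R : realType) (X : completeNormedModType R[i]).
Implicit Types A B C : bop X X.

(** With zero corner the first component evolves by [A] alone, so [A] inherits finite descent. Both
    diagonal entries then have Fitting decompositions, which pass to any corner [C], and [B] has
    finite ascent. *)
Lemma browder_optri A B C l : browder_at (opdiag A B) l ->
  [/\ browder_at (optri A C B) l & has_SVEP_at B l].
Proof.
rewrite opdiag_optri => /browder_fitting[n]; rewrite optri_shift => fM.
have [_ rM _] := fM.
have iter_fst k p : (iter k (optri (A - l *: idop X) 0 (B - l *: idop X)) p).1 =
    iter k (A - l *: idop X) p.1.
  elim: k => //= k <-.
  by rewrite -[LHS]/((A - l *: idop X) _ + 0) addr0.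
have [x|fA fB] := optri_fitting fM.
  have [p xp] := rM (x, 0); exists p.1.
  by rewrite -iter_fst -xp iter_fst.
split; last by have [kB _ _] := fB; exact: SVEP_of_ascent kB.
have [m fMC] := fitting_optri C fA fB.
by apply: (@fitting_browder _ _ _ _ m); rewrite optri_shift.
Qed.

(** Either extension property yields the hypothesis of [optri_descent]; the decompositions of [A]
    and [B] then recombine with zero corner. *)
Lemma browder_opdiag A B C l : browder_at (optri A C B) l ->
  has_SVEP_at (adjoint A) l \/ has_SVEP_at B l -> browder_at (opdiag A B) l.
Proof.
move=> /browder_fitting[n]; rewrite optri_shift.
set A' := A - _; set B' := B - _.
(* The index is raised because [drazin_inverse] asks for a positive one. *)
move=> /(fitting_mono (leqnSn n)) fM svep; have [kM rM fk] := fM.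
set M := optri A' C B' in fM kM rM fk.
have [N [P [MN NM NP MP Pid]]] := drazin_inverse fM.
have NP0 x : N (P x) = 0 by have [] := NP x.
have PN0 x : P (N x) = 0 by have [] := NP x.
have [|fA fB] := optri_fitting fM.
  apply: (optri_descent MN PN0 MP) => x.
  have [As|Bs] := svep.
    pose K2 := sndop X X @` [set x | iter n.+1 M x = 0].
    have sK2 : subspace K2 by exact/subspace_bop_image/iter_ker_subspace.
    have fk2 : findim K2 by apply: (findim_bop_image (f := sndop X X) fk).
    have [s sK Ks] := findim_basis sK2 fk2.
    apply: contrapT => no.
    have [h [hs hx]] : exists h : dual X, (forall y, fspan s y -> h y = 0) /\
        h (iter n.+1 N (x, 0)).2 != 0.
      apply: findim_separates => xs; apply: no.
      have [k kM0 kE] := fspan_mono sK2 sK xs.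
      by exists k.
    (* The induction moves one factor [N] from the vector into the functional; generality in [z] is
       needed because [z] becomes [compop z N], which again vanishes on the first summand by the
       property of the adjoint. *)
    have step j (z : dual (X * X)%type) : (forall x, z (P x) = 0) ->
        (forall x, z (inlop X X x) = 0) -> z (iter j N (x, 0)) = 0.
      elim: j z => [|j IH] z zP zJ; first exact: (zJ x).
      rewrite -[LHS]/(compop z N (iter j N (x, 0))); apply: IH => y.
        by rewrite -[LHS]/(z (N (P y))) NP0 linear0.
      apply: (SVEP_adjoint_step NM NP0 As) => // w.
      exact/esym/(iter_optri_inl A' B' C 1).
    move/eqP: hx; apply; apply: (step n.+1 (compop h (sndop X X))) => y.
      by apply/hs/Ks; exists (P y) => //; exact: MP.
    exact: (linear0 h).
  (* Each further factor [N] is gained from the property of [B], as [L] intertwines [M] with [B']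
     and kills the range of [P]. *)
  have step j : (iter n.+1 M (iter j N (x, 0))).2 = 0.
    elim: j => [|j IH]; first by rewrite iter_optri_inl.
    pose L := compop (sndop X X) (powop M n.+1).
    have LE v : L v = (iter n.+1 M v).2 by rewrite -powopE.
    rewrite -LE; apply: (SVEP_step MN Bs) => [v|v|].
    - by rewrite !LE -iterSr !iter_optri_snd.
    - by rewrite LE MP.
    - by rewrite LE.
  (* Taking [j = 2n + 2], the product [M^(n+1) N^(n+1)] cancels to [1 - P], which fixes the range of
     [N]; so the second component of [N^(n+1) (x, 0)] is zero. *)
  exists 0; first by rewrite (iter0 M).
  have := step (n.+1 + n.+1)%N; rewrite iterDn (iter_drazin MN PN0).
  by rewrite iterS PN0 subr0.
rewrite opdiag_optri; have [m fM0] := fitting_optri 0 fA fB.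
by apply: (@fitting_browder _ _ _ _ m); rewrite optri_shift.
Qed.

End Main.

Theorem proposition2p1 (R : realType) (X : completeNormedModType R[i])
    (A B C : bop X X) :
  browder_spectrum (opdiag A B) =
    browder_spectrum (optri A C B) `|` (Xi (adjoint A) `&` Xi B).
Proof.
apply/seteqP; split=> l /=.
  move=> nb; apply: contrapT => /not_orP[/contrapT bM nX]; apply: nb.
  apply: (browder_opdiag bM).
  by have /not_andP[/contrapT|/contrapT] := nX; [left|right].
by move=> [nb|[_ nB]] bd; have [] := browder_optri C bd.
Qed.
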